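(* Assume that $\sigma(B)\subset[\delta,\infty)$ for some $\delta>0$. Then: i) For any $X(0)\in\mathcal V$, the function $$X(t)=\Lambda^{-1}e^{-iHt}\Lambda X(0)\in C(\mathbb R,\mathcal V)$$ is the unique solution in $C(\mathbb R,\mathcal V)$, with the given initial value $X(0)$, to the equation $\dot X(t)=AX(t)$, $t\in\mathbb R$, understood in the sense $$A^{-1}[X(t)-X(0)]=\int_0^tX(s)\,ds,\qquad t\in\mathbb R .$$ ii) The dynamical group $V(t):X(0)\mapsto X(t)$ is unitary in $\mathcal V$; that is, $\Vert X(t)\Vert_{\mathcal V}=\Vert X(0)\Vert_{\mathcal V}$ for all $t\in\mathbb R$.
   Context: $\mathcal X$ is a complex Hilbert space; $B$ is a selfadjoint operator in $\mathcal X$ with dense domain $D(B)$; $J$ is a bounded linear operator in $\mathcal X$ with $J^*=-J$ and $J^2=-1$; $A=JB$. $\Lambda:=B^{1/2}$ is the positive square root, and $\mathcal V:=D(\Lambda)$ is the Hilbert space with the norm $\Vert X\Vert_{\mathcal V}=\Vert\Lambda X\Vert_{\mathcal X}$. Under the spectral assumption, $A^{-1}=-B^{-1}J:\mathcal X\to\mathcal V$ is bounded, and $H=\Lambda iJ\Lambda$ with domain $D(H)=\{X\in\mathcal V: J\Lambda X\in\mathcal V\}$ is a densely defined selfadjoint operator in $\mathcal X$. The integral $\int_0^tX(s)\,ds$ is a Riemann integral converging in $\mathcal V$. *)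

(* Defs.v *)
From Stdlib Require Export Reals.
From Stdlib Require Import ClassicalEpsilon.
From Coquelicot Require Export Coquelicot.

Local Open Scope R_scope.

(** The inner product is linear in its first argument. Definiteness follows
    from [inner_norm] and [norm_eq_zero]. *)
Record ComplexHilbert := {
  hilbert_space :> CompleteNormedModule C_AbsRing;
  inner : hilbert_space -> hilbert_space -> C;
  inner_plus : forall x y z,
    inner (plus x y) z = Cplus (inner x z) (inner y z);
  inner_scal : forall (c : C) x y,
    inner (scal c x) y = Cmult c (inner x y);
  inner_conj : forall x y, inner y x = Cconj (inner x y);
  inner_norm : forall x, inner x x = RtoC (norm x ^ 2)
}.

Arguments inner {_} _ _.

(** Coquelicot's [Riemann_sum] needs a module over [R]: restriction of
    scalars from [C] to [R], on the same additive group. *)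
Section RestrictScalars.

Context (X : ComplexHilbert).

Let rscal (r : R) (x : X) : X := scal (RtoC r) x.

Lemma rscal_assoc (r s : R) (x : X) :
  rscal r (rscal s x) = rscal (mult r s) x.
Proof.
  unfold rscal. rewrite scal_assoc. f_equal. symmetry. apply RtoC_mult.
Qed.

Lemma rscal_one (x : X) : rscal one x = x.
Proof. exact (scal_one x). Qed.

Lemma rscal_distr_l (r : R) (x y : X) :
  rscal r (plus x y) = plus (rscal r x) (rscal r y).
Proof. exact (scal_distr_l (RtoC r) x y). Qed.

Lemma rscal_distr_r (r s : R) (x : X) :
  rscal (plus r s) x = plus (rscal r x) (rscal s x).
Proof.
  unfold rscal.
  transitivity (scal (plus (RtoC r) (RtoC s)) x).
  - f_equal. apply RtoC_plus.
  - exact (scal_distr_r (RtoC r) (RtoC s) x).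
Qed.

Definition real_module : ModuleSpace R_Ring :=
  ModuleSpace.Pack R_Ring X
    (ModuleSpace.Class R_Ring X (AbelianGroup.class X)
       (ModuleSpace.Mixin R_Ring (AbelianGroup.Pack X (AbelianGroup.class X) X)
          rscal rscal_assoc rscal_one rscal_distr_l rscal_distr_r))
    X.

End RestrictScalars.

(** A partially defined operator; the values of [app] outside [dom] are
    irrelevant. Linearity is the separate predicate [linear_op]. *)
Record Op (X : ComplexHilbert) := mkOp {
  dom : X -> Prop;
  app :> X -> X
}.

Arguments mkOp {X} _ _.
Arguments dom {X} _ _.
Arguments app {X} _ _.

Definition linear_op {X : ComplexHilbert} (T : Op X) : Prop :=
  dom T zero /\
  (forall x y, dom T x -> dom T y ->
     dom T (plus x y) /\ T (plus x y) = plus (T x) (T y)) /\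
  (forall (c : C) x, dom T x ->
     dom T (scal c x) /\ T (scal c x) = scal c (T x)).

Definition op_eq {X : ComplexHilbert} (S T : Op X) : Prop :=
  (forall x, dom S x <-> dom T x) /\ (forall x, dom S x -> S x = T x).

Definition everywhere {X : ComplexHilbert} (T : X -> X) : Op X :=
  mkOp (fun _ => True) T.

Definition op_comp {X : ComplexHilbert} (S T : Op X) : Op X :=
  mkOp (fun x => dom T x /\ dom S (T x)) (fun x => S (T x)).

Definition op_scal {X : ComplexHilbert} (c : C) (T : Op X) : Op X :=
  mkOp (dom T) (fun x => scal c (T x)).

(** The inverse on the range of [T], meaningful when [T] is injective. *)
Definition op_inv {X : ComplexHilbert} (T : Op X) (y : X) : X :=
  epsilon (inhabits zero) (fun x => dom T x /\ T x = y).

Definition dense {X : ComplexHilbert} (D : X -> Prop) : Prop :=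
  forall (x : X) (eps : R), 0 < eps -> exists y, D y /\ norm (minus y x) < eps.

(** [(y, z)] is in the graph of the adjoint of [T] (a function if [T] is
    densely defined). *)
Definition adjoint_graph {X : ComplexHilbert} (T : Op X) (y z : X) : Prop :=
  forall x, dom T x -> inner (T x) y = inner x z.

Definition selfadjoint {X : ComplexHilbert} (T : Op X) : Prop :=
  linear_op T /\ dense (dom T) /\
  forall y z, adjoint_graph T y z <-> (dom T y /\ T y = z).

Definition positive_op {X : ComplexHilbert} (T : Op X) : Prop :=
  forall x, dom T x -> 0 <= Re (inner (T x) x).

Definition is_positive_sqrt {X : ComplexHilbert} (B L : Op X) : Prop :=
  selfadjoint L /\ positive_op L /\ op_eq (op_comp L L) B.

(** Coquelicot's [is_linear] includes boundedness. *)
Definition resolvent_set {X : ComplexHilbert} (T : Op X) (z : C) : Prop :=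
  exists S : X -> X,
    is_linear S /\
    (forall y, dom T (S y) /\ minus (T (S y)) (scal z (S y)) = y) /\
    (forall x, dom T x -> S (minus (T x) (scal z x)) = x).

Definition spectrum {X : ComplexHilbert} (T : Op X) (z : C) : Prop :=
  ~ resolvent_set T z.

(** [U] is a strongly continuous group of bounded operators and [G] is
    exactly its generator, domain included. *)
Definition is_C0_group {X : ComplexHilbert} (G : Op X) (U : R -> X -> X) : Prop :=
  (forall t, is_linear (U t)) /\
  (forall x, U 0 x = x) /\
  (forall s t x, U (s + t) x = U s (U t x)) /\
  (forall x t, continuous (fun s => U s x) t) /\
  (forall x y,
     (dom G x /\ G x = y) <->
     filterlim (fun h : R => scal (RtoC (/ h)) (minus (U h x) x))
       (locally' 0) (locally y)).

(** [op_exp G t] is [e^{tG}], the [C_0]-group generated by [G]. A generator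
    determines its group; the value is arbitrary if [G] generates none. *)
Definition op_exp {X : ComplexHilbert} (G : Op X) : R -> X -> X :=
  epsilon (inhabits (fun _ x => x)) (is_C0_group G).

(** The energy space: [dom L], with the inner product [(L x, L y)]. *)
Definition V_norm {X : ComplexHilbert} (L : Op X) (x : X) : R := norm (L x).

Definition V_locally {X : ComplexHilbert} (L : Op X) (x : X) (P : X -> Prop) : Prop :=
  exists eps : posreal,
    forall y, dom L y -> V_norm L (minus y x) < eps -> P y.

Definition V_continuous {X : ComplexHilbert} (L : Op X) (f : R -> X) : Prop :=
  (forall t, dom L (f t)) /\
  (forall t, filterlim f (locally t) (V_locally L (f t))).

(** [is_RInt] with convergence in the energy space. *)
Definition is_V_RInt {X : ComplexHilbert} (L : Op X)
    (f : R -> X) (a b : R) (I : X) : Prop :=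
  dom L I /\
  filterlim
    (fun ptd => scal (RtoC (sign (b - a))) (Riemann_sum (V := real_module X) f ptd))
    (Riemann_fine a b) (V_locally L I).

(** Linear, onto, and preserving the inner product of the energy space. *)
Definition V_unitary {X : ComplexHilbert} (L : Op X) (W : X -> X) : Prop :=
  (forall x, dom L x -> dom L (W x)) /\
  (forall x y, dom L x -> dom L y -> W (plus x y) = plus (W x) (W y)) /\
  (forall (c : C) x, dom L x -> W (scal c x) = scal c (W x)) /\
  (forall y, dom L y -> exists x, dom L x /\ W x = y) /\
  (forall x y, dom L x -> dom L y ->
     inner (L (W x)) (L (W y)) = inner (L x) (L y)).

Definition op_A {X : ComplexHilbert} (B : Op X) (J : X -> X) : Op X :=
  op_comp (everywhere J) B.

Definition op_H {X : ComplexHilbert} (L : Op X) (J : X -> X) : Op X :=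
  op_comp L (op_comp (op_scal Ci (everywhere J)) L).

(** [L^{-1} e^{-iHt} L]. *)
Definition flow {X : ComplexHilbert} (L : Op X) (J : X -> X) (t : R) (x : X) : X :=
  op_inv L (op_exp (op_scal (Copp Ci) (op_H L J)) t (L x)).

Definition V_solution {X : ComplexHilbert} (B L : Op X) (J : X -> X)
    (f : R -> X) : Prop :=
  forall t, is_V_RInt L f 0 t (op_inv (op_A B J) (minus (f t) (f 0))).

(* Main.v *)
(** With [P = L^{-1}], the inverse of the unbounded generator [-iH] is the bounded
    skew-symmetric injective operator [T = - P J P], so everything about [-iH] can be
    said in terms of [T]. The group is the limit of the implicit Euler scheme
    [C(t/2^k)^(2^k)], [C(tau) = (1 - tau T^{-1})^{-1}]: these steps are commuting
    contractions, and on the dense range of [T^2] the defect of [C(a+b)] against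
    [C(a) C(b)] is quadratic in the steps, so telescoping gives convergence and the
    group law. Skewness of [T] makes [|W(t) T z|] constant for every group [W]
    generated by [-iH]. After applying [L], the integral equation reads
    [T z(t) - T z(0) = int_0^t z]; the difference [w] of two solutions satisfies
    [(T w)' = w], which is orthogonal to [T w], so [|T w|] is constant and [w = 0]. *)

Require Import Defs.
From Stdlib Require Import Lra Lia List Classical ClassicalEpsilon.
Import ListNotations.
Local Open Scope R_scope.

(** * A decision procedure for linear identities *)

(** [op_exp] is a choice among the groups generated by [-iH]: one such group has to be constructed
    first, with its exact domain, and every later property is derived from [is_C0_group] alone.
    Hence the split between the constructed [skew_group] and an arbitrary [W]. Writing the Euler
    step as T(y - x) = tau y keeps tau = 0 in the family, and skewness makes the step a contraction
    for both signs of tau, so the scheme yields a group at once rather than two semigroups. The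
    quadratic defect comes from C(tau) T z = T z + tau C(tau) z: each T in front of z is traded for
    a factor tau, and two of them suffice because 2^k defects of order 4^{-k} add up to order
    2^{-k}. Powers of two are used because level k+1 at time t is level k at time t/2 applied twice,
    so that convergence and the group law come from one estimate. *)

Inductive vexp :=
  | VZero | VAtom (n : nat) | VPlus (a b : vexp) | VOpp (a : vexp)
  | VMinus (a b : vexp) | VScal (c : C) (a : vexp).

Fixpoint veval {X : ModuleSpace C_Ring} (env : list X) (e : vexp) : X :=
  match e with
  | VZero => zero
  | VAtom n => nth n env zero
  | VPlus a b => plus (veval env a) (veval env b)
  | VOpp a => opp (veval env a)
  | VMinus a b => minus (veval env a) (veval env b)
  | VScal c a => scal c (veval env a)
  end.

Fixpoint vcoef (e : vexp) (n : nat) : C :=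
  match e with
  | VZero => RtoC 0
  | VAtom m => if Nat.eqb m n then RtoC 1 else RtoC 0
  | VPlus a b => Cplus (vcoef a n) (vcoef b n)
  | VOpp a => Copp (vcoef a n)
  | VMinus a b => Cminus (vcoef a n) (vcoef b n)
  | VScal c a => Cmult c (vcoef a n)
  end.

Fixpoint lincomb {X : ModuleSpace C_Ring} (env : list X) (f : nat -> C) : X :=
  match env with
  | [] => zero
  | x :: l => plus (scal (f O) x) (lincomb l (fun n => f (S n)))
  end.

(** A conjunction rather than a quantified statement: on a concrete list it computes to one complex
    equation per atom, which [vec_with] separates and splits into real and imaginary parts. *)
Fixpoint coef_eq (len : nat) (f g : nat -> C) : Prop :=
  match len with
  | O => True
  | S n => f O = g O /\ coef_eq n (fun k => f (S k)) (fun k => g (S k))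
  end.

Section Lincomb.
Context {X : ModuleSpace C_Ring}.
Implicit Types (env : list X) (f g : nat -> C).

Lemma lincomb_zero env : lincomb env (fun _ => RtoC 0) = zero.
Proof.
  induction env as [|x l IH]; simpl; [easy|].
  rewrite IH. change (RtoC 0) with (@zero C_Ring).
  rewrite scal_zero_l. apply plus_zero_l.
Qed.

Lemma lincomb_plus env f g :
  lincomb env (fun n => Cplus (f n) (g n)) = plus (lincomb env f) (lincomb env g).
Proof.
  revert f g; induction env as [|x l IH]; intros f g; simpl.
  - symmetry; apply plus_zero_l.
  - rewrite (IH (fun n => f (S n)) (fun n => g (S n))).
    rewrite (scal_distr_r (f O : C_Ring) (g O) x : scal (Cplus (f O) (g O)) x = _).
    rewrite <- !plus_assoc. f_equal. rewrite !plus_assoc. f_equal. apply plus_comm.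
Qed.

Lemma lincomb_scal env (c : C) f :
  lincomb env (fun n => Cmult c (f n)) = scal c (lincomb env f).
Proof.
  revert f; induction env as [|x l IH]; intros f; simpl.
  - symmetry; apply (scal_zero_r (c : C_Ring)).
  - rewrite (IH (fun n => f (S n))).
    rewrite (scal_distr_l (c : C_Ring)). f_equal.
    symmetry. apply (scal_assoc (c : C_Ring)).
Qed.

Lemma lincomb_ext env f g :
  coef_eq (length env) f g -> lincomb env f = lincomb env g.
Proof.
  revert f g; induction env as [|x l IH]; intros f g H; simpl in *; [easy|].
  destruct H as [H0 H]. rewrite H0. f_equal. apply IH, H.
Qed.

Lemma coef_eq_ext len f g : (forall n, f n = g n) -> coef_eq len f g.
Proof. revert f g; induction len as [|k IH]; simpl; auto. Qed.

Lemma lincomb_atom env m :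
  lincomb env (fun n => if Nat.eqb m n then RtoC 1 else RtoC 0) = nth m env zero.
Proof.
  revert m; induction env as [|x l IH]; intros [|m]; simpl; try easy.
  - rewrite (lincomb_zero l). rewrite (scal_one x : scal (RtoC 1) x = x).
    apply plus_zero_r.
  - rewrite IH. change (RtoC 0) with (@zero C_Ring).
    rewrite scal_zero_l. apply plus_zero_l.
Qed.

Lemma lincomb_opp env f : lincomb env (fun n => Copp (f n)) = opp (lincomb env f).
Proof.
  rewrite <- (scal_opp_one (lincomb env f)).
  change (opp (@one C_Ring)) with (Copp (RtoC 1)).
  rewrite <- lincomb_scal. apply lincomb_ext, coef_eq_ext. intros n; ring.
Qed.

Lemma veval_lincomb env e : veval env e = lincomb env (vcoef e).
Proof.
  induction e; simpl.
  - symmetry; apply lincomb_zero.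
  - symmetry; apply lincomb_atom.
  - rewrite IHe1, IHe2. symmetry; apply lincomb_plus.
  - rewrite IHe. symmetry; apply lincomb_opp.
  - rewrite IHe1, IHe2. unfold minus. rewrite <- lincomb_opp.
    symmetry; apply (lincomb_plus env (vcoef e1) (fun n => Copp (vcoef e2 n))).
  - rewrite IHe. symmetry; apply lincomb_scal.
Qed.

Lemma veval_eq env e1 e2 :
  coef_eq (length env) (vcoef e1) (vcoef e2) -> veval env e1 = veval env e2.
Proof. rewrite !veval_lincomb. apply lincomb_ext. Qed.

End Lincomb.

Ltac vec_index x l :=
  match l with
  | x :: _ => constr:(O)
  | _ :: ?t => let n := vec_index x t in constr:(S n)
  end.

Ltac vec_add x l :=
  match l with
  | context [cons x _] => l
  | _ => constr:(x :: l)
  end.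

Ltac vec_atoms e l :=
  lazymatch e with
  | zero => l
  | plus ?a ?b => let l := vec_atoms a l in vec_atoms b l
  | minus ?a ?b => let l := vec_atoms a l in vec_atoms b l
  | opp ?a => vec_atoms a l
  | scal _ ?a => vec_atoms a l
  | ?x => vec_add x l
  end.

Ltac vec_reify e l :=
  lazymatch e with
  | zero => constr:(VZero)
  | plus ?a ?b => let a := vec_reify a l in let b := vec_reify b l in constr:(VPlus a b)
  | minus ?a ?b => let a := vec_reify a l in let b := vec_reify b l in constr:(VMinus a b)
  | opp ?a => let a := vec_reify a l in constr:(VOpp a)
  | scal ?c ?a => let a := vec_reify a l in constr:(VScal c a)
  | ?x => let n := vec_index x l in constr:(VAtom n)
  end.

Ltac vec_with tac :=
  lazymatch goal with
  | |- @eq ?T ?a ?b =>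
    let l := vec_atoms a (@nil T) in
    let l := vec_atoms b l in
    let ea := vec_reify a l in
    let eb := vec_reify b l in
    refine (veval_eq l ea eb _);
    repeat split; apply injective_projections; simpl; tac
  end.

Ltac vec := vec_with ltac:(try ring).
Ltac vec_field := vec_with ltac:(try field; auto).

(** * The underlying real space *)

Section RealSpace.
Context (X : ComplexHilbert).

Lemma real_norm_scal (r : R) (x : X) :
  norm (scal (RtoC r) x) <= Rabs r * norm x.
Proof. rewrite <- Cmod_R. apply (norm_scal (RtoC r : C_AbsRing) x). Qed.

Let modclass : ModuleSpace.class_of R_Ring X := ModuleSpace.class R_Ring (real_module X).

Let auxclass : NormedModuleAux.class_of R_AbsRing X :=
  NormedModuleAux.Class R_AbsRing X modclass (UniformSpace.class X).

Let normclass : NormedModule.class_of R_AbsRing X :=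
  NormedModule.Class R_AbsRing X auxclass
    (NormedModule.Mixin R_AbsRing
       (NormedModuleAux.Pack R_AbsRing X auxclass X)
       (norm : X -> R) (@norm_factor _ X) norm_triangle real_norm_scal
       norm_compat1 norm_compat2 norm_eq_zero).

(** Restriction of scalars keeps the uniform structure and the norm, so limits in [X] and in
    [real_space X] agree by conversion; the real structure gives access to [is_derive] and
    [is_RInt]. *)
Definition real_space : CompleteNormedModule R_AbsRing :=
  CompleteNormedModule.Pack R_AbsRing X
    (CompleteNormedModule.Class R_AbsRing X normclass
       (CompleteSpace.mixin X (CompleteSpace.class X))) X.

End RealSpace.

Lemma filterlim_norm {T : Type} {K : AbsRing} {V : NormedModule K}
    {F : (T -> Prop) -> Prop} {FF : Filter F} (f : T -> V) (y : V) :
  filterlim f F (locally y) <->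
  forall eps, 0 < eps -> F (fun t => norm (minus (f t) y) < eps).
Proof.
  split.
  - intros H eps Heps. apply (H (fun u => norm (minus u y) < eps)).
    apply locally_le_locally_norm. exists (mkposreal eps Heps). easy.
  - intros H P HP. apply locally_norm_le_locally in HP. destruct HP as [eps HP].
    refine (filter_imp _ (fun t => P (f t)) _ (H eps (cond_pos eps))). intros t; apply HP.
Qed.

(** * Norm estimates and bounded linear maps *)

Section Norm.
Context {X : ComplexHilbert}.
Implicit Types x y z : X.

Lemma hnorm_triangle x y : norm (plus x y) <= norm x + norm y.
Proof. exact (norm_triangle (V := X) x y). Qed.

Lemma hnorm_opp x : norm (opp x) = norm x.
Proof. exact (norm_opp (V := X) x). Qed.

Lemma hnorm_zero : norm (zero : X) = 0.
Proof. exact (norm_zero (V := X)). Qed.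

Lemma hnorm_ge_0 x : 0 <= norm x.
Proof. exact (norm_ge_0 (V := X) x). Qed.

Lemma minus_self x : minus x x = (zero : X).
Proof. exact (minus_eq_zero (G := X) x). Qed.

Lemma norm_minus_sym x y : norm (minus x y) = norm (minus y x).
Proof. rewrite <- hnorm_opp. f_equal. vec. Qed.

Lemma norm_minus_triangle x y z :
  norm (minus x z) <= norm (minus x y) + norm (minus y z).
Proof.
  replace (minus x z) with (plus (minus x y) (minus y z)) by vec.
  apply hnorm_triangle.
Qed.

Lemma norm_minus_le x y : norm (minus x y) <= norm x + norm y.
Proof. rewrite <- (hnorm_opp y). apply (hnorm_triangle x (opp y)). Qed.

Lemma minus_eq_0 x y : minus x y = zero -> x = y.
Proof.
  intros H. transitivity (plus (minus x y) y); [vec|]. rewrite H. vec.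
Qed.

Lemma eq_of_norm_small x y :
  (forall eps, 0 < eps -> norm (minus x y) <= eps) -> x = y.
Proof.
  intros H. apply minus_eq_0, (norm_eq_zero (V := X)).
  apply Rle_antisym; [|apply hnorm_ge_0].
  apply le_epsilon. intros eps Heps. rewrite Rplus_0_l. auto.
Qed.

Lemma lin_plus (f : X -> X) x y : is_linear f -> f (plus x y) = plus (f x) (f y).
Proof. intros Hf. exact (linear_plus f Hf x y). Qed.

Lemma lin_scal (f : X -> X) (c : C) x : is_linear f -> f (scal c x) = scal c (f x).
Proof. intros Hf. exact (linear_scal f Hf c x). Qed.

Lemma lin_opp (f : X -> X) x : is_linear f -> f (opp x) = opp (f x).
Proof.
  intros Hf. replace (opp x) with (scal (RtoC (-1)) x) by vec.
  rewrite (lin_scal _ _ _ Hf). vec.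
Qed.

Lemma lin_minus (f : X -> X) x y :
  is_linear f -> f (minus x y) = minus (f x) (f y).
Proof.
  intros Hf. unfold minus. rewrite (lin_plus _ _ _ Hf), (lin_opp _ _ Hf). reflexivity.
Qed.

Lemma lin_zero (f : X -> X) : is_linear f -> f zero = zero.
Proof.
  intros Hf. replace (zero : X) with (minus zero zero : X) by vec.
  rewrite (lin_minus _ _ _ Hf). vec.
Qed.

End Norm.

(** * The real part of the inner product *)

Section Inner.
Context {X : ComplexHilbert}.
Implicit Types x y z : X.

(** Norms, skewness and derivatives of squared norms are statements about the real part; [inner_im]
    recovers the imaginary part through multiplication by [Ci]. *)
Definition rinner x y : R := Re (inner x y).

Lemma rinner_plus_l x y z : rinner (plus x y) z = rinner x z + rinner y z.
Proof. unfold rinner. rewrite inner_plus. reflexivity. Qed.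

Lemma rinner_scal_l (r : R) x y : rinner (scal (RtoC r) x) y = r * rinner x y.
Proof. unfold rinner. rewrite inner_scal. unfold Re, Im. simpl. ring. Qed.

Lemma rinner_sym x y : rinner x y = rinner y x.
Proof. unfold rinner. rewrite (inner_conj _ x y). reflexivity. Qed.

Lemma rinner_plus_r x y z : rinner x (plus y z) = rinner x y + rinner x z.
Proof. rewrite !(rinner_sym x). apply rinner_plus_l. Qed.

Lemma rinner_scal_r (r : R) x y : rinner x (scal (RtoC r) y) = r * rinner x y.
Proof. rewrite !(rinner_sym x). apply rinner_scal_l. Qed.

Lemma rinner_opp_l x y : rinner (opp x) y = - rinner x y.
Proof.
  replace (opp x) with (scal (RtoC (-1)) x) by vec.
  rewrite rinner_scal_l. ring.
Qed.

Lemma rinner_opp_r x y : rinner x (opp y) = - rinner x y.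
Proof. rewrite !(rinner_sym x). apply rinner_opp_l. Qed.

Lemma rinner_minus_l x y z : rinner (minus x y) z = rinner x z - rinner y z.
Proof. unfold minus. rewrite rinner_plus_l, rinner_opp_l. ring. Qed.

Lemma rinner_minus_r x y z : rinner x (minus y z) = rinner x y - rinner x z.
Proof. rewrite !(rinner_sym x). apply rinner_minus_l. Qed.

Lemma rinner_norm x : rinner x x = norm x ^ 2.
Proof. unfold rinner. rewrite inner_norm. reflexivity. Qed.

Lemma norm_plus_sqr x y :
  norm (plus x y) ^ 2 = norm x ^ 2 + 2 * rinner x y + norm y ^ 2.
Proof.
  rewrite <- !rinner_norm, rinner_plus_l, !rinner_plus_r, (rinner_sym y x). ring.
Qed.

(** Cauchy-Schwarz, read off from the triangle inequality: after squaring, only the cross terms are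
    left. *)
Lemma rinner_le x y : rinner x y <= norm x * norm y.
Proof.
  pose proof (norm_plus_sqr x y) as H.
  assert (H1 : norm (plus x y) ^ 2 <= (norm x + norm y) ^ 2).
  { apply pow_incr. split; [apply hnorm_ge_0 | apply hnorm_triangle]. }
  nra.
Qed.

Lemma rinner_abs_le x y : Rabs (rinner x y) <= norm x * norm y.
Proof.
  apply Rabs_le. split; [|apply rinner_le].
  pose proof (rinner_le (opp x) y) as H. rewrite rinner_opp_l, hnorm_opp in H. lra.
Qed.

Lemma norm_scal_eq (r : R) x : norm (scal (RtoC r) x) = Rabs r * norm x.
Proof.
  assert (H : norm (scal (RtoC r) x) ^ 2 = (Rabs r * norm x) ^ 2).
  { rewrite <- rinner_norm, rinner_scal_l, rinner_scal_r, rinner_norm.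
    rewrite Rpow_mult_distr, pow2_abs. ring. }
  pose proof (hnorm_ge_0 (scal (RtoC r) x)). pose proof (hnorm_ge_0 x).
  pose proof (Rabs_pos r).
  apply Rsqr_inj; [lra | nra |]. unfold Rsqr. nra.
Qed.

Lemma inner_im x y : Im (inner x y) = - rinner (scal Ci x) y.
Proof. unfold rinner. rewrite inner_scal. unfold Re, Im. simpl. ring. Qed.

(** By polarization. *)
Lemma linear_isometry_inner (W : X -> X) :
  is_linear W -> (forall x, norm (W x) = norm x) ->
  forall x y, inner (W x) (W y) = inner x y.
Proof.
  intros HW Hn.
  assert (Hr : forall x y, rinner (W x) (W y) = rinner x y).
  { intros x y. pose proof (norm_plus_sqr x y) as H.
    pose proof (norm_plus_sqr (W x) (W y)) as H'.
    rewrite <- (lin_plus _ _ _ HW), !Hn in H'. lra. }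
  intros x y. apply injective_projections; [exact (Hr x y)|].
  change (Im (inner (W x) (W y)) = Im (inner x y)).
  rewrite !inner_im. f_equal. rewrite <- (lin_scal _ _ _ HW). apply Hr.
Qed.

(** The derivative of [norm u ^ 2] is [2 * rinner du u = 0]. This serves twice: for the isometry of
    groups and for the uniqueness of solutions. *)
Lemma norm_constant (u du : R -> X) :
  (forall t, is_derive (V := real_space X) u t (du t)) ->
  (forall t, rinner (du t) (u t) = 0) ->
  forall t, norm (u t) = norm (u 0).
Proof.
  intros Hu Ho.
  assert (Hd : forall t, is_derive (fun s => norm (u s) ^ 2 : R) t 0).
  (* [is_derive] unfolds to linearity of the differential and a little-o estimate at every limit of
     the filter; that limit can only be [t]. *)
  { intros t. split; [apply (is_linear_scal_l (K := R_AbsRing))|].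
    intros t' Ht'.
    rewrite <- (is_filter_lim_locally_unique (V := R_NormedModule) _ _ Ht'). clear t' Ht'.
    destruct (Hu t) as [_ Hd]. specialize (Hd t (fun P HP => HP)).
    intros eps.
    set (M := norm (u t)). set (N := norm (du t)).
    assert (HM : 0 <= M) by apply hnorm_ge_0. assert (HN : 0 <= N) by apply hnorm_ge_0.
    assert (Heps := cond_pos eps).
    (* [e1 <= 1] gives [norm d <= (N + 1) |s - t|]; the other bound keeps the inner product term
       below [eps |s - t| / 2]. The neighbourhood [Hs] does the same for [norm d ^ 2]. *)
    set (e1 := Rmin 1 (eps / (4 * (M + 1)))).
    assert (He1 : 0 < e1).
    { apply Rmin_pos; [lra|]. apply Rdiv_lt_0_compat; lra. }
    specialize (Hd (mkposreal _ He1)).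
    assert (Hs : locally t (fun s : R => Rabs (s - t) < eps / (2 * (N + 1) ^ 2))).
    { assert (Hp : 0 < eps / (2 * (N + 1) ^ 2)) by (apply Rdiv_lt_0_compat; nra).
      exists (mkposreal _ Hp). intros s Hs. exact Hs. }
    generalize (filter_and _ _ Hd Hs). apply filter_imp. clear Hd Hs.
    intros s [H1 H2].
    set (d := minus (u s) (u t)).
    assert (H1' : norm (minus d (scal (RtoC (s - t)) (du t))) <= e1 * Rabs (s - t))
      by exact H1. clear H1.
    assert (Hdn : norm d <= (N + 1) * Rabs (s - t)).
    { replace d with (plus (minus d (scal (RtoC (s - t)) (du t))) (scal (RtoC (s - t)) (du t))) by vec.
      eapply Rle_trans; [apply hnorm_triangle|]. rewrite norm_scal_eq. fold N.
      assert (e1 <= 1) by apply Rmin_l. pose proof (Rabs_pos (s - t)). nra. }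
    (* Orthogonality of [du t] and [u t] leaves only the remainder of the derivative in this
       product. *)
    assert (Hin : Rabs (rinner d (u t)) <= e1 * Rabs (s - t) * M).
    { replace (rinner d (u t))
        with (rinner (minus d (scal (RtoC (s - t)) (du t))) (u t)).
      - eapply Rle_trans; [apply rinner_abs_le|]. fold M. apply Rmult_le_compat_r; easy.
      - rewrite rinner_minus_l, rinner_scal_l, Ho. ring. }
    change (Rabs (minus (minus (norm (u s) ^ 2) (norm (u t) ^ 2)) (scal (minus s t) 0))
            <= eps * Rabs (s - t)).
    replace (minus (minus (norm (u s) ^ 2) (norm (u t) ^ 2)) (scal (minus s t) 0))
      with (2 * rinner d (u t) + norm d ^ 2).
    2:{ replace (u s) with (plus d (u t)) by (unfold d; vec). rewrite norm_plus_sqr.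
        unfold minus, plus, opp, scal; simpl. unfold mult; simpl. ring. }
    eapply Rle_trans; [apply Rabs_triang|].
    rewrite Rabs_mult, (Rabs_right 2), (Rabs_right (norm d ^ 2)) by (try lra; apply Rle_ge, pow2_ge_0).
    pose proof (Rabs_pos (s - t)) as Ha. pose proof (hnorm_ge_0 d) as Hdp.
    set (a := Rabs (s - t)) in *.
    assert (A1 : 2 * (e1 * M) <= eps / 2).
    { assert (e1 <= eps / (4 * (M + 1))) by apply Rmin_r.
      apply Rle_trans with (2 * (eps / (4 * (M + 1)) * (M + 1))); [|right; field; lra].
      apply Rmult_le_compat_l; [lra|]. apply Rmult_le_compat; lra. }
    assert (A2 : (N + 1) ^ 2 * a <= eps / 2).
    { apply Rle_trans with ((N + 1) ^ 2 * (eps / (2 * (N + 1) ^ 2))).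
      - apply Rmult_le_compat_l; [apply pow2_ge_0|lra].
      - right; field; lra. }
    assert (A3 : norm d ^ 2 <= ((N + 1) * a) ^ 2) by (apply pow_incr; lra).
    apply Rle_trans with (2 * (e1 * a * M) + ((N + 1) * a) ^ 2); [lra|].
    replace (2 * (e1 * a * M) + ((N + 1) * a) ^ 2)
      with ((2 * (e1 * M)) * a + ((N + 1) ^ 2 * a) * a) by ring.
    nra. }
  assert (Hlt : forall a b, a < b -> norm (u a) ^ 2 = norm (u b) ^ 2).
  { intros a b Hab. apply (eq_is_derive (fun s => norm (u s) ^ 2 : R)); auto. }
  intros t.
  assert (Hsq : norm (u t) ^ 2 = norm (u 0) ^ 2).
  { destruct (Rtotal_order t 0) as [H|[->|H]]; auto. symmetry; auto. }
  apply Rsqr_inj; try apply hnorm_ge_0. unfold Rsqr. lra.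
Qed.

End Inner.

(** * The group generated by the inverse of a skew-symmetric operator *)

Lemma half_pow_small (c eps : R) :
  0 < eps -> exists N, forall k, (N <= k)%nat -> c / 2 ^ k < eps.
Proof.
  intros Heps.
  destruct (Pow_x_infinity 2 ltac:(rewrite Rabs_right; lra) ((Rabs c + 1) / eps)) as [N HN].
  exists N. intros k Hk. specialize (HN k Hk).
  pose proof (pow_lt 2 k ltac:(lra)) as Hp.
  rewrite Rabs_right in HN by lra.
  apply Rmult_lt_reg_r with (2 ^ k); [easy|].
  unfold Rdiv. rewrite Rmult_assoc, Rinv_l, Rmult_1_r by lra.
  apply Rle_lt_trans with (1 := Rle_abs c).
  apply Rge_le in HN. apply (Rmult_le_compat_r eps) in HN; [|lra].
  unfold Rdiv in HN. rewrite Rmult_assoc, Rinv_l, Rmult_1_r in HN by lra. lra.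
Qed.

(** * Commuting contractions and successive approximation *)

Section Contractions.
Context {X : ComplexHilbert}.

Definition contraction (f : X -> X) : Prop :=
  is_linear f /\ forall x, norm (f x) <= norm x.

Lemma contraction_intro (f : X -> X) :
  (forall x y, f (plus x y) = plus (f x) (f y)) ->
  (forall (c : C) x, f (scal c x) = scal c (f x)) ->
  (forall x, norm (f x) <= norm x) -> contraction f.
Proof.
  intros H1 H2 H3. split; [|exact H3]. split; [exact H1 | exact H2|].
  exists 1. split; [lra|]. intros x. rewrite Rmult_1_l. apply H3.
Qed.

Lemma contraction_dist (f : X -> X) x y :
  contraction f -> norm (minus (f x) (f y)) <= norm (minus x y).
Proof. intros [H1 H2]. rewrite <- (lin_minus _ _ _ H1). apply H2. Qed.

Lemma contraction_id : contraction (fun x => x).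
Proof. apply contraction_intro; auto using Rle_refl. Qed.

Lemma contraction_comp (f g : X -> X) :
  contraction f -> contraction g -> contraction (fun x => f (g x)).
Proof.
  intros [Hf Hf'] [Hg Hg']. split.
  - apply (is_linear_comp g f); assumption.
  - intros x. eapply Rle_trans; eauto.
Qed.

Lemma contraction_iter (f : X -> X) n : contraction f -> contraction (Nat.iter n f).
Proof.
  intros Hf. induction n as [|n IH].
  - apply contraction_id.
  - apply (contraction_comp f (Nat.iter n f)); assumption.
Qed.

Lemma iter_commute (f g : X -> X) n x :
  (forall y, f (g y) = g (f y)) -> Nat.iter n f (g x) = g (Nat.iter n f x).
Proof. intros H. induction n as [|n IH]; simpl; [|rewrite IH, H]; reflexivity. Qed.

Lemma iter_comp (f g : X -> X) n x :
  (forall y, f (g y) = g (f y)) ->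
  Nat.iter n (fun y => f (g y)) x = Nat.iter n f (Nat.iter n g x).
Proof.
  intros H. induction n as [|n IH]; [reflexivity|]. simpl. rewrite IH. f_equal.
  symmetry. apply (iter_commute f g). assumption.
Qed.

(** The difference at [n + 1] is split at [f^n (g x)]. Commutation moves the single [g] outside, so
    every defect is measured at the same point [x]; this is what allows [x] to be confined to a
    dense range. *)
Lemma iter_telescope (f g : X -> X) n x :
  contraction f -> contraction g -> (forall y, f (g y) = g (f y)) ->
  norm (minus (Nat.iter n f x) (Nat.iter n g x)) <= INR n * norm (minus (f x) (g x)).
Proof.
  intros Hf Hg Hc. induction n as [|n IH].
  - simpl. rewrite minus_self.
    rewrite hnorm_zero. lra.
  - rewrite S_INR, !Nat.iter_succ_r.
    eapply Rle_trans; [apply (norm_minus_triangle _ (Nat.iter n f (g x)))|].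
    rewrite Rmult_plus_distr_r, Rmult_1_l, Rplus_comm. apply Rplus_le_compat.
    + rewrite (iter_commute f g), (iter_commute g g) by auto.
      eapply Rle_trans; [apply contraction_dist, Hg | exact IH].
    + apply contraction_dist, contraction_iter, Hf.
Qed.

Lemma contraction_eq_dense (D : X -> Prop) (f g : X -> X) :
  dense D -> contraction f -> contraction g ->
  (forall x, D x -> f x = g x) -> forall x, f x = g x.
Proof.
  intros HD Hf Hg H x. apply eq_of_norm_small. intros eps Heps.
  destruct (HD x (eps / 2)) as [y [Hy Hxy]]; [lra|].
  eapply Rle_trans; [apply (norm_minus_triangle _ (f y))|].
  rewrite (H y Hy) at 2.
  pose proof (contraction_dist f x y Hf). pose proof (contraction_dist g y x Hg).
  rewrite (norm_minus_sym x y) in *. lra.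
Qed.

(** By successive approximation: the residuals decrease geometrically. *)
Lemma approx_onto (D : X -> X) (q M : R) :
  is_linear D -> 0 <= q < 1 ->
  (forall x, exists y, norm (minus x (D y)) <= q * norm x /\ norm y <= M * norm x) ->
  forall x, exists y, D y = x.
Proof.
  intros HD Hq H x.
  destruct (choice (fun x y => norm (minus x (D y)) <= q * norm x /\ norm y <= M * norm x) H)
    as [f Hf].
  set (r := fun n => Nat.iter n (fun r => minus r (D (f r))) x).
  assert (Hr : forall n, norm (r n) <= norm x * q ^ n).
  { intros n. induction n as [|n IH]; [simpl; lra|].
    simpl. eapply Rle_trans; [apply (proj1 (Hf (r n)))|].
    pose proof (Rmult_le_compat_l q _ _ (proj1 Hq) IH). lra. }
  assert (HM : forall n, norm (f (r n)) <= Rabs M * norm x * q ^ n).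
  { intros n. eapply Rle_trans; [apply (proj2 (Hf (r n)))|].
    rewrite Rmult_assoc. apply Rle_trans with (Rabs M * norm (r n)).
    - apply Rmult_le_compat_r; [apply hnorm_ge_0 | apply Rle_abs].
    - apply Rmult_le_compat_l; [apply Rabs_pos | apply Hr]. }
  destruct (ex_series_le (V := X) (fun n => f (r n)) (fun n => Rabs M * norm x * q ^ n))
    as [l Hl]; [exact HM | |].
  { apply (ex_series_scal (K := R_AbsRing) (V := R_NormedModule)).
    apply ex_series_geom. rewrite Rabs_right; lra. }
  exists l. destruct (linear_norm _ HD) as [K [HK HKb]].
  assert (Hsum : forall n, D (sum_n (G := X) (fun n => f (r n)) n) = minus x (r (S n))).
  { intros n. induction n as [|n IH].
    - rewrite sum_O. simpl. vec.
    - rewrite sum_Sn. rewrite (lin_plus _ _ _ HD), IH. simpl. vec. }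
  apply eq_of_norm_small. intros eps Heps.
  apply (filterlim_norm (V := X)) with (eps := eps / 2 / K) in Hl.
  2: apply Rdiv_lt_0_compat; lra.
  destruct Hl as [N1 HN1].
  destruct (pow_lt_1_zero q ltac:(rewrite Rabs_right; lra) (eps / 2 / (norm x + 1))) as [N2 HN2].
  { pose proof (hnorm_ge_0 x). apply Rdiv_lt_0_compat; lra. }
  set (n := (N1 + N2)%nat).
  specialize (HN1 n ltac:(lia)). specialize (HN2 (S n) ltac:(lia)).
  set (s := sum_n (G := X) (fun n => f (r n)) n) in *.
  replace (minus (D l) x) with (opp (plus (D (minus s l)) (r (S n)))).
  2:{ rewrite (lin_minus _ _ _ HD). unfold s. rewrite Hsum. vec. }
  rewrite hnorm_opp. eapply Rle_trans; [apply hnorm_triangle|].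
  apply Rle_trans with (eps / 2 + eps / 2); [|lra]. apply Rplus_le_compat.
  - eapply Rle_trans; [apply HKb|]. apply Rlt_le in HN1.
    apply (Rmult_le_compat_l K) in HN1; [|lra].
    replace (K * (eps / 2 / K)) with (eps / 2) in HN1 by (field; lra). exact HN1.
  - eapply Rle_trans; [apply Hr|]. pose proof (hnorm_ge_0 x).
    assert (q ^ S n <= eps / 2 / (norm x + 1)).
    { eapply Rle_trans; [apply Rle_abs | apply Rlt_le, HN2]. }
    apply Rle_trans with ((norm x + 1) * (eps / 2 / (norm x + 1))); [|right; field; lra].
    apply Rmult_le_compat; try lra. apply pow_le; lra.
Qed.

End Contractions.

(** * Resolvent and Euler steps of a skew-symmetric operator *)

Section Skew.
Context {X : ComplexHilbert} (T : X -> X).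
Implicit Types (x y z : X) (a b s t tau : R).
Hypothesis T_linear : is_linear T.
Hypothesis T_skew : forall x y, rinner (T x) y = - rinner x (T y).
Hypothesis T_inj : forall x, T x = zero -> x = zero.
Hypothesis T_dense : dense (fun y => exists x, T x = y).

Lemma skew_diag x : rinner (T x) x = 0.
Proof. pose proof (T_skew x x) as H. rewrite (rinner_sym x) in H. lra. Qed.

(** The cross term [rinner (T y) y] vanishes, so the squared norm is the sum of those of [T y] and
    [tau y]. *)
Lemma shift_lower_bound (tau : R) y :
  Rabs tau * norm y <= norm (minus (T y) (scal (RtoC tau) y)).
Proof.
  assert (H : norm (minus (T y) (scal (RtoC tau) y)) ^ 2
              = norm (T y) ^ 2 + (Rabs tau * norm y) ^ 2).
  { rewrite <- rinner_norm, rinner_minus_l, !rinner_minus_r,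
      !rinner_scal_l, !rinner_scal_r, (rinner_sym y), skew_diag, !rinner_norm,
      Rpow_mult_distr, pow2_abs. ring. }
  pose proof (hnorm_ge_0 (minus (T y) (scal (RtoC tau) y))).
  pose proof (pow2_ge_0 (norm (T y))).
  apply Rsqr_incr_0_var; [unfold Rsqr; lra | assumption].
Qed.

Definition shift_onto (tau : R) : Prop :=
  forall x, exists y, minus (T y) (scal (RtoC tau) y) = x.

Lemma shift_linear (tau : R) : is_linear (fun y => minus (T y) (scal (RtoC tau) y)).
Proof.
  destruct (linear_norm _ T_linear) as [K [HK HKb]].
  split.
  - intros x y. rewrite (lin_plus _ _ _ T_linear). vec.
  - intros c x. rewrite (lin_scal _ _ _ T_linear). vec.
  - exists (K + Rabs tau). pose proof (Rabs_pos tau). split; [lra|]. intros x.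
    eapply Rle_trans; [apply (norm_minus_le (T x))|].
    rewrite norm_scal_eq. specialize (HKb x). lra.
Qed.

(** The solution [y] at [tau] misses the equation at [tau'] by [(tau' - tau) y], and
    [norm y <= norm x / |tau|] makes this at most half of [norm x]. *)
Lemma shift_onto_step (tau tau' : R) :
  tau <> 0 -> Rabs (tau' - tau) <= Rabs tau / 2 -> shift_onto tau -> shift_onto tau'.
Proof.
  intros H0 Hd H.
  refine (approx_onto _ (1 / 2) (/ Rabs tau) (shift_linear tau') _ _); [lra|].
  intros x. destruct (H x) as [y Hy]. exists y.
  pose proof (shift_lower_bound tau y) as Hb. rewrite Hy in Hb.
  pose proof (Rabs_pos_lt tau H0). pose proof (hnorm_ge_0 y). split.
  - replace (minus x _) with (scal (RtoC (tau' - tau)) y) by (rewrite <- Hy; vec).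
    rewrite norm_scal_eq. nra.
  - apply Rmult_le_reg_l with (Rabs tau); [easy|].
    rewrite <- Rmult_assoc, Rinv_r by lra. lra.
Qed.

(** Method of continuity: for a large parameter [s] the Neumann guess [y = - x / s] has residual
    [T x / s]; the parameter is then halved down to [tau], each halving being just within reach of
    [shift_onto_step]. *)
Lemma shift_onto_all (tau : R) : tau <> 0 -> shift_onto tau.
Proof.
  intros Htau. destruct (linear_norm _ T_linear) as [K [HK HKb]].
  pose proof (Rabs_pos_lt tau Htau) as Hp.
  destruct (Pow_x_infinity 2 ltac:(rewrite Rabs_right; lra) (2 * K / Rabs tau)) as [N HN].
  specialize (HN N (le_n N)). pose proof (pow_lt 2 N ltac:(lra)) as H2.
  rewrite Rabs_right in HN by lra.
  assert (Hlarge : shift_onto (2 ^ N * tau)).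
  { assert (Hb : 2 * K <= Rabs (2 ^ N * tau)).
    { rewrite Rabs_mult, (Rabs_right (2 ^ N)) by lra. apply Rge_le in HN.
      apply (Rmult_le_compat_r (Rabs tau)) in HN; [|lra].
      unfold Rdiv in HN. rewrite Rmult_assoc, Rinv_l in HN by lra. lra. }
    assert (Hn0 : 2 ^ N * tau <> 0) by (apply Rmult_integral_contrapositive; split; lra).
    pose proof (Rabs_pos_lt _ Hn0) as Hpos.
    set (s := 2 ^ N * tau) in *.
    refine (approx_onto _ (1 / 2) (/ Rabs s) (shift_linear s) _ _); [lra|].
    intros x. exists (scal (RtoC (- / s)) x). split.
    - replace (minus x _) with (scal (RtoC (/ s)) (T x)).
      2:{ rewrite (lin_scal _ _ _ T_linear). vec_field. }
      rewrite norm_scal_eq, Rabs_inv.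
      apply Rmult_le_reg_l with (Rabs s); [easy|].
      rewrite <- Rmult_assoc, Rinv_r, Rmult_1_l by lra.
      specialize (HKb x). pose proof (hnorm_ge_0 x). nra.
    - rewrite norm_scal_eq, Rabs_Ropp, Rabs_inv. lra. }
  clear HN H2. induction N as [|N IH].
  - simpl in Hlarge. rewrite Rmult_1_l in Hlarge. exact Hlarge.
  - apply IH. pose proof (pow_lt 2 N ltac:(lra)) as H2.
    apply (shift_onto_step (2 ^ S N * tau)); [| | exact Hlarge].
    + apply Rmult_integral_contrapositive. split; [apply pow_nonzero; lra | easy].
    + replace (2 ^ N * tau - 2 ^ S N * tau) with (- (2 ^ N * tau)) by (simpl; ring).
      replace (2 ^ S N * tau) with (2 * (2 ^ N * tau)) by (simpl; ring).
      rewrite Rabs_Ropp, (Rabs_mult 2), (Rabs_right 2) by lra. lra.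
Qed.

(** The implicit Euler step [(1 - tau G)^{-1}] for [G = T^{-1}], with
    [y - x = tau G y] written without [G]. *)
Definition euler_step (tau : R) (x : X) : X :=
  epsilon (inhabits zero) (fun y => T (minus y x) = scal (RtoC tau) y).

Lemma euler_step_spec tau x :
  T (minus (euler_step tau x) x) = scal (RtoC tau) (euler_step tau x).
Proof.
  unfold euler_step. apply epsilon_spec.
  (* For [tau <> 0] the relation reads [(T - tau) y = T x]; at [tau = 0] the witness is [x]
     itself. *)
  destruct (Req_dec tau 0) as [->|H].
  - exists x. rewrite minus_self.
    rewrite (lin_zero _ T_linear). vec.
  - destruct (shift_onto_all tau H (T x)) as [y Hy]. exists y.
    rewrite (lin_minus _ _ _ T_linear), <- Hy. vec.
Qed.

(** The difference [d] of two solutions satisfies [T d = tau d], while skewness gives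
    [rinner (T d) d = 0]: either [d = 0], or [tau = 0] and injectivity of [T] concludes. *)
Lemma euler_step_unique tau x y :
  T (minus y x) = scal (RtoC tau) y -> euler_step tau x = y.
Proof.
  intros H. pose proof (euler_step_spec tau x) as H'.
  set (y' := euler_step tau x) in *. apply minus_eq_0.
  assert (Hd : T (minus y' y) = scal (RtoC tau) (minus y' y)).
  { replace (minus y' y) with (minus (minus y' x) (minus y x)) at 1 by vec.
    rewrite (lin_minus _ _ _ T_linear), H, H'. vec. }
  pose proof (skew_diag (minus y' y)) as H0.
  rewrite Hd, rinner_scal_l, rinner_norm in H0.
  apply Rmult_integral in H0. destruct H0 as [H0|H0].
  - apply T_inj. rewrite Hd, H0. vec.
  - apply (norm_eq_zero (V := X)). apply Rsqr_0_uniq. unfold Rsqr.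
    rewrite <- H0. simpl. rewrite Rmult_1_r. reflexivity.
Qed.

Lemma euler_step_0 x : euler_step 0 x = x.
Proof.
  apply euler_step_unique. rewrite minus_self.
  rewrite (lin_zero _ T_linear). vec.
Qed.

Lemma euler_step_commute (S : X -> X) tau x :
  is_linear S -> (forall y, S (T y) = T (S y)) ->
  euler_step tau (S x) = S (euler_step tau x).
Proof.
  intros HS Hc. apply euler_step_unique.
  rewrite <- (lin_minus _ _ _ HS), <- Hc, euler_step_spec. apply lin_scal, HS.
Qed.

(** Let [y] be the step of [x] and [tau <> 0]. Skewness at [y - x], with [T (y - x) = tau y], gives
    [rinner y (y - x) = 0], hence [norm y ^ 2 = rinner y x]. The sign of [tau] drops out. *)
Lemma euler_step_contraction tau : contraction (euler_step tau).
Proof.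
  apply contraction_intro.
  - intros x y. apply euler_step_unique.
    replace (minus _ _) with
      (plus (minus (euler_step tau x) x) (minus (euler_step tau y) y)) by vec.
    rewrite (lin_plus _ _ _ T_linear), !euler_step_spec. vec.
  - intros c x. apply euler_step_unique.
    replace (minus _ _) with (scal c (minus (euler_step tau x) x)) by vec.
    rewrite (lin_scal _ _ _ T_linear), euler_step_spec. vec.
  - intros x. destruct (Req_dec tau 0) as [->|Ht].
    { rewrite euler_step_0. lra. }
    pose proof (skew_diag (minus (euler_step tau x) x)) as H.
    rewrite euler_step_spec, rinner_scal_l in H.
    apply Rmult_integral in H. destruct H as [H|H]; [contradiction|].
    rewrite rinner_minus_r, rinner_norm in H.
    pose proof (rinner_le (euler_step tau x) x).
    pose proof (hnorm_ge_0 (euler_step tau x)). pose proof (hnorm_ge_0 x).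
    destruct (Req_dec (norm (euler_step tau x)) 0); nra.
Qed.

Lemma euler_step_T_commute tau x : euler_step tau (T x) = T (euler_step tau x).
Proof. apply euler_step_commute; auto. Qed.

Lemma euler_steps_commute s t x :
  euler_step s (euler_step t x) = euler_step t (euler_step s x).
Proof.
  apply euler_step_commute; [apply euler_step_contraction|].
  apply euler_step_T_commute.
Qed.

Lemma euler_step_T tau z :
  euler_step tau (T z) = plus (T z) (scal (RtoC tau) (euler_step tau z)).
Proof.
  rewrite <- euler_step_spec, <- (lin_plus _ _ _ T_linear), euler_step_T_commute.
  f_equal. vec.
Qed.

Lemma euler_step_consistency a b z :
  norm (minus (euler_step (a + b) (T (T z))) (euler_step a (euler_step b (T (T z)))))
  <= 2 * (Rabs a + Rabs b) ^ 2 * norm z.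
Proof.
  destruct (euler_step_contraction a) as [La Ca].
  destruct (euler_step_contraction b) as [Lb Cb].
  destruct (euler_step_contraction (a + b)) as [Lab Cab].
  rewrite !euler_step_T, !(lin_plus _ _ _ La), !(lin_scal _ _ _ La), !euler_step_T,
    !(lin_plus _ _ _ La), !(lin_scal _ _ _ La), !euler_step_T.
  set (u := euler_step (a + b) z). set (v := euler_step a z).
  set (w := euler_step a (euler_step b z)).
  (* Once each [T] is expanded by [euler_step_T], the terms [T (T z)] and [(a + b) T z] cancel and
     only second-order coefficients remain. *)
  match goal with |- norm ?e <= _ => replace e with
    (minus (scal (RtoC ((a + b) ^ 2)) u)
       (plus (scal (RtoC (a ^ 2 + a * b)) v) (scal (RtoC (b ^ 2)) w))) by vec end.
  eapply Rle_trans; [apply norm_minus_le|].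
  eapply Rle_trans; [apply Rplus_le_compat_l, hnorm_triangle|].
  rewrite !norm_scal_eq.
  assert (norm u <= norm z) by apply Cab. assert (norm v <= norm z) by apply Ca.
  assert (norm w <= norm z) by (eapply Rle_trans; [apply Ca | apply Cb]).
  assert (E1 : Rabs ((a + b) ^ 2) <= (Rabs a + Rabs b) ^ 2).
  { rewrite <- RPow_abs. apply pow_incr. split; [apply Rabs_pos | apply Rabs_triang]. }
  assert (E2 : Rabs (a ^ 2 + a * b) <= Rabs a ^ 2 + Rabs a * Rabs b).
  { rewrite RPow_abs, <- Rabs_mult. apply Rabs_triang. }
  assert (E3 : Rabs (b ^ 2) = Rabs b ^ 2) by (rewrite RPow_abs; reflexivity).
  pose proof (Rabs_pos a). pose proof (Rabs_pos b). pose proof (hnorm_ge_0 z).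
  (* Each of the two expansions contributes at most [(|a| + |b|)^2 norm z], whence the factor 2. *)
  apply Rle_trans with ((Rabs a + Rabs b) ^ 2 * norm z
    + ((Rabs a ^ 2 + Rabs a * Rabs b) * norm z + Rabs b ^ 2 * norm z)).
  - rewrite E3. repeat apply Rplus_le_compat; apply Rmult_le_compat;
      auto using Rabs_pos, hnorm_ge_0, pow2_ge_0, Rle_refl.
  - assert (0 <= Rabs a * Rabs b * norm z) by (repeat apply Rmult_le_pos; auto). nra.
Qed.

(** * Convergence of the dyadic Euler scheme *)

Definition euler (k : nat) (t : R) : X -> X :=
  Nat.iter (2 ^ k) (euler_step (t / 2 ^ k)).

Lemma INR_pow2 k : INR (2 ^ k) = 2 ^ k.
Proof. rewrite pow_INR. reflexivity. Qed.

Lemma euler_contraction k t : contraction (euler k t).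
Proof. apply contraction_iter, euler_step_contraction. Qed.

Lemma euler_commute (S : X -> X) k t x :
  is_linear S -> (forall y, S (T y) = T (S y)) -> euler k t (S x) = S (euler k t x).
Proof.
  intros HS Hc. apply (iter_commute (euler_step (t / 2 ^ k)) S).
  intros y. apply euler_step_commute; assumption.
Qed.

Lemma euler_0 k x : euler k 0 x = x.
Proof.
  unfold euler. replace (0 / 2 ^ k) with 0 by (unfold Rdiv; ring).
  induction (2 ^ k)%nat as [|n IH]; simpl; [|rewrite IH, euler_step_0]; reflexivity.
Qed.

Lemma euler_add k s t z :
  norm (minus (euler k (s + t) (T (T z))) (euler k s (euler k t (T (T z)))))
  <= 2 * (Rabs s + Rabs t) ^ 2 * norm z / 2 ^ k.
Proof.
  pose proof (pow_lt 2 k ltac:(lra)) as H2.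
  unfold euler.
  rewrite <- (iter_comp (euler_step (s / 2 ^ k)) (euler_step (t / 2 ^ k)))
    by (intros; apply euler_steps_commute).
  eapply Rle_trans; [apply iter_telescope|].
  - apply euler_step_contraction.
  - apply contraction_comp; apply euler_step_contraction.
  - intros y. rewrite (euler_steps_commute ((s + t) / 2 ^ k)). f_equal.
    apply euler_steps_commute.
  - rewrite INR_pow2.
    replace ((s + t) / 2 ^ k) with (s / 2 ^ k + t / 2 ^ k) by (field; lra).
    eapply Rle_trans; [apply Rmult_le_compat_l; [lra | apply euler_step_consistency]|].
    right. unfold Rdiv. rewrite !Rabs_mult, !(Rabs_right (/ 2 ^ k)).
    + field. lra.
    + apply Rle_ge, Rlt_le, Rinv_0_lt_compat, H2.
Qed.

(** Halving the step size turns level [k] at [t] into level [k] at [t / 2] applied twice, so this is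
    [euler_add] for two equal halves. *)
Lemma euler_succ k t z :
  norm (minus (euler (S k) t (T (T z))) (euler k t (T (T z))))
  <= 2 * t ^ 2 * norm z / 2 ^ k.
Proof.
  pose proof (pow_lt 2 k ltac:(lra)) as H2.
  assert (H : euler (S k) t (T (T z)) = euler k (t / 2) (euler k (t / 2) (T (T z)))).
  { unfold euler. replace (t / 2 ^ S k) with (t / 2 / 2 ^ k) by (simpl; field; lra).
    rewrite <- Nat.iter_add. f_equal. simpl. lia. }
  rewrite H, norm_minus_sym.
  replace (euler k t) with (euler k (t / 2 + t / 2)) by (f_equal; field).
  eapply Rle_trans; [apply euler_add|]. right.
  replace (Rabs (t / 2) + Rabs (t / 2)) with (Rabs t).
  - rewrite pow2_abs. reflexivity.
  - unfold Rdiv. rewrite Rabs_mult, (Rabs_right (/ 2)) by lra. field.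
Qed.

Lemma euler_dist k m t z :
  (k <= m)%nat ->
  norm (minus (euler m t (T (T z))) (euler k t (T (T z)))) <= 4 * t ^ 2 * norm z / 2 ^ k.
Proof.
  intros Hkm. set (c := t ^ 2 * norm z).
  assert (Hc : 0 <= c) by (apply Rmult_le_pos; [apply pow2_ge_0 | apply hnorm_ge_0]).
  (* The right side is the partial geometric sum of the increments [2 c / 2^j], in a form that the
     induction on [m] reproduces. *)
  assert (H : norm (minus (euler m t (T (T z))) (euler k t (T (T z))))
              <= 4 * c / 2 ^ k - 4 * c / 2 ^ m).
  { induction Hkm as [|m Hkm IH].
    - rewrite minus_self, hnorm_zero. lra.
    - eapply Rle_trans; [apply (norm_minus_triangle _ (euler m t (T (T z))))|].
      pose proof (euler_succ m t z) as H. rewrite Rmult_assoc in H. fold c in H.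
      pose proof (pow_lt 2 m ltac:(lra)) as H2.
      assert (E : 4 * c / 2 ^ S m = 4 * c / 2 ^ m - 2 * c / 2 ^ m) by (simpl; field; lra).
      lra. }
  assert (0 <= 4 * c / 2 ^ m) by (apply Rdiv_le_0_compat; [lra | apply pow_lt; lra]).
  replace (4 * t ^ 2 * norm z) with (4 * c) by (unfold c; ring). lra.
Qed.

Lemma T_sqr_dense : dense (fun y => exists z, T (T z) = y).
Proof.
  intros x eps Heps. destruct (linear_norm _ T_linear) as [K [HK HKb]].
  destruct (T_dense x (eps / 2)) as [y [[z <-] Hy]]; [lra|].
  destruct (T_dense z (eps / 2 / K)) as [y [[w <-] Hw]].
  { apply Rdiv_lt_0_compat; lra. }
  exists (T (T w)). split; [eauto|].
  eapply Rle_lt_trans; [apply (norm_minus_triangle _ (T z))|].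
  rewrite <- (lin_minus _ (T w) _ T_linear).
  pose proof (HKb (minus (T w) z)) as H.
  apply (Rmult_lt_compat_l K) in Hw; [|lra].
  replace (K * (eps / 2 / K)) with (eps / 2) in Hw by (field; lra). lra.
Qed.

(** On the range of [T^2] the scheme is Cauchy by [euler_dist]; contractivity, uniform in the level,
    extends this to every [x]. *)
Lemma euler_converges t x :
  exists y, filterlim (fun k => euler k t x) eventually (locally y).
Proof.
  apply (filterlim_locally_cauchy (U := X)). intros eps.
  assert (Heps := cond_pos eps).
  destruct (T_sqr_dense x (eps / 6)) as [y [[z <-] Hz]]; [lra|].
  destruct (half_pow_small (4 * t ^ 2 * norm z) (eps / 3)) as [N HN]; [lra|].
  exists (fun k => (N <= k)%nat). split; [exists N; auto|].
  assert (Hb : forall u v, (N <= u)%nat -> (u <= v)%nat ->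
            norm (minus (euler v t x) (euler u t x)) < eps).
  { intros u v Hu Huv.
    pose proof (euler_dist u v t z Huv) as H. specialize (HN u Hu).
    pose proof (contraction_dist _ x (T (T z)) (euler_contraction v t)) as H1.
    pose proof (contraction_dist _ (T (T z)) x (euler_contraction u t)) as H2.
    rewrite (norm_minus_sym x) in H1.
    eapply Rle_lt_trans; [apply (norm_minus_triangle _ (euler v t (T (T z))))|].
    eapply Rle_lt_trans;
      [apply Rplus_le_compat_l, (norm_minus_triangle _ (euler u t (T (T z))))|].
    lra. }
  intros u v Hu Hv. apply (norm_compat1 (V := X)).
  destruct (Nat.le_ge_cases u v).
  - apply (Hb u v); assumption.
  - pose proof (Hb v u Hv H) as H'. rewrite norm_minus_sym in H'. exact H'.
Qed.

(** * The limit group and its generator *)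

Definition skew_group (t : R) (x : X) : X :=
  epsilon (inhabits zero) (fun y => filterlim (fun k => euler k t x) eventually (locally y)).

Lemma skew_group_lim t x eps :
  0 < eps ->
  exists N, forall k, (N <= k)%nat -> norm (minus (euler k t x) (skew_group t x)) < eps.
Proof.
  intros Heps.
  pose proof (epsilon_spec (inhabits zero) _ (euler_converges t x)) as H.
  apply (filterlim_norm (V := X)) with (eps := eps) in H; assumption.
Qed.

Lemma skew_group_unique t x y :
  (forall eps, 0 < eps ->
     exists N, forall k, (N <= k)%nat -> norm (minus (euler k t x) y) < eps) ->
  skew_group t x = y.
Proof.
  intros H. apply eq_of_norm_small. intros eps Heps.
  destruct (H (eps / 2)) as [N HN]; [lra|].
  destruct (skew_group_lim t x (eps / 2)) as [N' HN']; [lra|].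
  specialize (HN (N + N')%nat ltac:(lia)). specialize (HN' (N + N')%nat ltac:(lia)).
  eapply Rle_trans; [apply (norm_minus_triangle _ (euler (N + N') t x))|].
  rewrite norm_minus_sym. lra.
Qed.

(** A bound uniform in the level survives the limit; contractivity, the Lipschitz and the Taylor
    estimates all pass through it. *)
Lemma skew_group_bound t x y c :
  (forall k, norm (minus (euler k t x) y) <= c) -> norm (minus (skew_group t x) y) <= c.
Proof.
  intros H. apply le_epsilon. intros eps Heps.
  destruct (skew_group_lim t x eps Heps) as [N HN].
  specialize (HN N (le_n N)). specialize (H N).
  eapply Rle_trans; [apply (norm_minus_triangle _ (euler N t x))|].
  rewrite norm_minus_sym. lra.
Qed.

Lemma skew_group_commute (S : X -> X) t x :
  is_linear S -> (forall y, S (T y) = T (S y)) ->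
  skew_group t (S x) = S (skew_group t x).
Proof.
  intros HS Hc. apply skew_group_unique. intros eps Heps.
  destruct (linear_norm _ HS) as [K [HK HKb]].
  destruct (skew_group_lim t x (eps / K)) as [N HN]; [apply Rdiv_lt_0_compat; lra|].
  exists N. intros k Hk. specialize (HN k Hk).
  rewrite (euler_commute S) by assumption. rewrite <- (lin_minus _ _ _ HS).
  eapply Rle_lt_trans; [apply HKb|].
  apply (Rmult_lt_compat_l K) in HN; [|lra].
  replace (K * (eps / K)) with eps in HN by (field; lra). exact HN.
Qed.

Lemma skew_group_contraction t : contraction (skew_group t).
Proof.
  apply contraction_intro.
  - intros x y. apply skew_group_unique. intros eps Heps.
    destruct (skew_group_lim t x (eps / 2)) as [N HN]; [lra|].
    destruct (skew_group_lim t y (eps / 2)) as [N' HN']; [lra|].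
    exists (N + N')%nat. intros k Hk.
    specialize (HN k ltac:(lia)). specialize (HN' k ltac:(lia)).
    rewrite (lin_plus _ _ _ (proj1 (euler_contraction k t))).
    match goal with |- norm ?e < _ => replace e with
      (plus (minus (euler k t x) (skew_group t x)) (minus (euler k t y) (skew_group t y)))
      by vec end.
    eapply Rle_lt_trans; [apply hnorm_triangle|]. lra.
  - intros c x. apply (skew_group_commute (fun x => scal c x)).
    + split.
      * intros y z. vec.
      * intros d y. vec.
      (* [is_linear] demands a strictly positive bound, and [Cmod c] may vanish. *)
      * exists (Cmod c + 1). pose proof (Cmod_ge_0 c). split; [lra|]. intros y.
        eapply Rle_trans; [apply (norm_scal (V := X) (c : C_AbsRing))|].
        apply Rmult_le_compat_r; [apply hnorm_ge_0|]. change (Cmod c <= Cmod c + 1). lra.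
    + intros y. symmetry. apply lin_scal, T_linear.
  - intros x. replace (skew_group t x) with (minus (skew_group t x) zero) by vec.
    apply skew_group_bound. intros k.
    replace (minus (euler k t x) zero) with (euler k t x) by vec. apply euler_contraction.
Qed.

Lemma skew_group_0 x : skew_group 0 x = x.
Proof.
  apply skew_group_unique. intros eps Heps. exists O. intros k _.
  rewrite euler_0. rewrite minus_self. rewrite hnorm_zero. exact Heps.
Qed.

(** Both sides are contractions, so it suffices to look at the range of [T^2], where the defect of
    [euler_add] tends to zero with the level. *)
Lemma skew_group_add s t x : skew_group (s + t) x = skew_group s (skew_group t x).
Proof.
  revert x. apply (contraction_eq_dense _ _ _ T_sqr_dense).
  - apply skew_group_contraction.
  - apply contraction_comp; apply skew_group_contraction.
  - intros x [z <-]. apply skew_group_unique. intros eps Heps.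
    set (x := T (T z)).
    destruct (half_pow_small (2 * (Rabs s + Rabs t) ^ 2 * norm z) (eps / 3)) as [N1 H1]; [lra|].
    destruct (skew_group_lim t x (eps / 3)) as [N2 H2]; [lra|].
    destruct (skew_group_lim s (skew_group t x) (eps / 3)) as [N3 H3]; [lra|].
    exists (N1 + N2 + N3)%nat. intros k Hk.
    specialize (H1 k ltac:(lia)). specialize (H2 k ltac:(lia)). specialize (H3 k ltac:(lia)).
    pose proof (euler_add k s t z) as H. fold x in H.
    pose proof (contraction_dist _ (euler k t x) (skew_group t x) (euler_contraction k s)).
    eapply Rle_lt_trans; [apply (norm_minus_triangle _ (euler k s (euler k t x)))|].
    eapply Rle_lt_trans;
      [apply Rplus_le_compat_l, (norm_minus_triangle _ (euler k s (skew_group t x)))|].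
    lra.
Qed.

(** One step of size [tau] moves [T z] by [tau] times a vector of norm at most [norm z]; telescoping
    against the identity sums these displacements. *)
Lemma skew_group_lipschitz t z : norm (minus (skew_group t (T z)) (T z)) <= Rabs t * norm z.
Proof.
  apply skew_group_bound. intros k. unfold euler.
  pose proof (pow_lt 2 k ltac:(lra)) as H2.
  assert (Hid : forall n, Nat.iter n (fun x : X => x) (T z) = T z) by (induction n; auto).
  rewrite <- (Hid (2 ^ k)%nat) at 2.
  eapply Rle_trans; [apply iter_telescope|].
  - apply euler_step_contraction.
  - apply contraction_id.
  - reflexivity.
  - rewrite INR_pow2, euler_step_T.
    replace (minus _ _) with (scal (RtoC (t / 2 ^ k)) (euler_step (t / 2 ^ k) z)) by vec.
    rewrite norm_scal_eq. unfold Rdiv at 1. rewrite Rabs_mult, Rabs_inv, (Rabs_right (2 ^ k)) by lra.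
    pose proof (proj2 (euler_step_contraction (t / 2 ^ k)) z).
    apply Rle_trans with (Rabs t * norm (euler_step (t / 2 ^ k) z)); [right; field; lra|].
    apply Rmult_le_compat_l; [apply Rabs_pos | assumption].
Qed.

(** Level 0, a single step, is exact to first order with remainder [t^2 euler_step t z], and lies
    within [4 t^2 norm z] of the limit; hence the constant 5. *)
Lemma skew_group_taylor t z :
  norm (minus (minus (skew_group t (T (T z))) (T (T z))) (scal (RtoC t) (T z)))
  <= 5 * t ^ 2 * norm z.
Proof.
  set (x := T (T z)).
  assert (H : norm (minus (skew_group t x) (euler 0 t x)) <= 4 * t ^ 2 * norm z).
  { apply skew_group_bound. intros k. pose proof (euler_dist 0 k t z ltac:(lia)) as H.
    simpl in H. unfold x. simpl. lra. }
  assert (H0 : euler 0 t x = plus x (plus (scal (RtoC t) (T z))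
                               (scal (RtoC (t ^ 2)) (euler_step t z)))).
  { unfold euler. simpl. replace (t / 1) with t by field.
    unfold x. rewrite !euler_step_T. vec. }
  replace (minus _ _) with
    (plus (minus (skew_group t x) (euler 0 t x)) (scal (RtoC (t ^ 2)) (euler_step t z)))
    by (rewrite H0; vec).
  eapply Rle_trans; [apply hnorm_triangle|].
  rewrite norm_scal_eq, Rabs_right by apply Rle_ge, pow2_ge_0.
  pose proof (proj2 (euler_step_contraction t) z). pose proof (pow2_ge_0 t). nra.
Qed.

Lemma skew_group_continuous x t : continuous (fun s => skew_group s x) t.
Proof.
  apply (filterlim_norm (V := X)). intros eps Heps.
  destruct (T_dense x (eps / 4)) as [y [[z <-] Hy]]; [lra|].
  assert (Hp : 0 < eps / 2 / (norm z + 1)).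
  { pose proof (hnorm_ge_0 z). repeat apply Rdiv_lt_0_compat; lra. }
  exists (mkposreal _ Hp). intros s Hs.
  change (Rabs (s - t) < eps / 2 / (norm z + 1)) in Hs.
  replace s with (t + (s - t)) by ring. rewrite skew_group_add.
  eapply Rle_lt_trans; [apply (contraction_dist (skew_group t)), skew_group_contraction|].
  set (h := s - t) in *.
  pose proof (contraction_dist _ x (T z) (skew_group_contraction h)) as H1.
  rewrite (norm_minus_sym x) in H1.
  pose proof (skew_group_lipschitz h z) as H2.
  assert (H3 : Rabs h * norm z <= eps / 2).
  { pose proof (hnorm_ge_0 z).
    apply Rle_trans with (eps / 2 / (norm z + 1) * (norm z + 1)); [|right; field; lra].
    apply Rmult_le_compat; auto using Rabs_pos, Rlt_le. lra. }
  eapply Rle_lt_trans; [apply (norm_minus_triangle _ (skew_group h (T z)))|].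
  eapply Rle_lt_trans; [apply Rplus_le_compat_l, (norm_minus_triangle _ (T z))|].
  lra.
Qed.

(** The Taylor bound needs [z] in the range of [T]. Replacing [z] by a nearby [T w] costs the
    difference quotient at [T (z - T w)], which the Lipschitz estimate bounds by [norm (z - T w)]
    uniformly in [h]. *)
Lemma skew_group_derivative z :
  filterlim (fun h : R => scal (RtoC (/ h)) (minus (skew_group h (T z)) (T z)))
    (locally' 0) (locally z).
Proof.
  apply (filterlim_norm (V := X)). intros eps Heps.
  destruct (T_dense z (eps / 4)) as [y [[w <-] Hw]]; [lra|].
  assert (Hp : 0 < eps / 4 / (5 * norm w + 1)).
  { pose proof (hnorm_ge_0 w). repeat apply Rdiv_lt_0_compat; lra. }
  exists (mkposreal _ Hp). intros h Hh Hh0.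
  change (Rabs (h - 0) < eps / 4 / (5 * norm w + 1)) in Hh. rewrite Rminus_0_r in Hh.
  pose proof (Rabs_pos_lt h Hh0) as Hpos.
  pose proof (skew_group_contraction h) as [Hl _].
  set (d := minus z (T w)).
  assert (Hd : norm d < eps / 4) by (unfold d; rewrite norm_minus_sym; exact Hw).
  replace (minus _ z) with
    (plus (scal (RtoC (/ h)) (minus (skew_group h (T d)) (T d)))
       (minus (scal (RtoC (/ h))
          (minus (minus (skew_group h (T (T w))) (T (T w))) (scal (RtoC h) (T w)))) d)).
  2:{ unfold d. rewrite (lin_minus _ _ _ T_linear), (lin_minus _ _ _ Hl). vec_field. }
  eapply Rle_lt_trans; [apply hnorm_triangle|].
  eapply Rle_lt_trans; [apply Rplus_le_compat_l, norm_minus_le|].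
  rewrite !norm_scal_eq, !Rabs_inv.
  assert (A1 : / Rabs h * norm (minus (skew_group h (T d)) (T d)) <= norm d).
  { apply Rmult_le_reg_l with (Rabs h); [easy|].
    rewrite <- Rmult_assoc, Rinv_r, Rmult_1_l by lra. apply skew_group_lipschitz. }
  assert (A2 : / Rabs h * norm (minus (minus (skew_group h (T (T w))) (T (T w)))
                                  (scal (RtoC h) (T w))) <= eps / 4).
  { apply Rmult_le_reg_l with (Rabs h); [easy|].
    rewrite <- Rmult_assoc, Rinv_r, Rmult_1_l by lra.
    eapply Rle_trans; [apply skew_group_taylor|]. rewrite <- (pow2_abs h).
    pose proof (hnorm_ge_0 w).
    assert (Rabs h * (5 * norm w) <= eps / 4).
    { apply Rle_trans with (eps / 4 / (5 * norm w + 1) * (5 * norm w + 1));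
        [|right; field; lra].
      apply Rmult_le_compat; lra. }
    nra. }
  lra.
Qed.

(** From left to right, the bounded [T] is applied to the convergent quotient: the quotient at [T x]
    tends to [T y], but also to [x]. So the domain of the generator is no larger than the range of
    [T]. *)
Lemma skew_group_generator x y :
  filterlim (fun h : R => scal (RtoC (/ h)) (minus (skew_group h x) x))
    (locally' 0) (locally y) <-> T y = x.
Proof.
  split; [|intros <-; apply skew_group_derivative].
  intros H.
  assert (H' : filterlim (fun h : R => scal (RtoC (/ h)) (minus (skew_group h (T x)) (T x)))
    (locally' 0) (locally (T y))).
  { eapply filterlim_ext; [|apply (filterlim_comp _ _ _ _ T _ _ _ H), (linear_cont (K := C_AbsRing) T y T_linear)].
    intros h. simpl. rewrite (lin_scal _ _ _ T_linear), (lin_minus _ _ _ T_linear).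
    rewrite (skew_group_commute T) by auto. reflexivity. }
  exact (filterlim_locally_unique (V := X) (FF := Proper_StrongProper _ (Rbar_locally'_filter 0))
    _ _ _ H' (skew_group_derivative x)).
Qed.

Lemma skew_generates_group (G : Op X) :
  (forall x y, (dom G x /\ G x = y) <-> T y = x) -> is_C0_group G skew_group.
Proof.
  intros HG. split; [|split; [|split; [|split]]].
  - intros t. apply skew_group_contraction.
  - apply skew_group_0.
  - apply skew_group_add.
  - apply skew_group_continuous.
  - intros x y. rewrite HG. symmetry. apply skew_group_generator.
Qed.

(** * Arbitrary groups generated by the inverse of T *)

Section Group.
Context (G : Op X) (W : R -> X -> X).
Hypothesis G_graph : forall x y, (dom G x /\ G x = y) <-> T y = x.
Hypothesis W_group : is_C0_group G W.

Lemma group_linear t : is_linear (W t).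
Proof. apply W_group. Qed.

Lemma group_0 x : W 0 x = x.
Proof. apply W_group. Qed.

Lemma group_add s t x : W (s + t) x = W s (W t x).
Proof. apply W_group. Qed.

Lemma group_continuous x t : continuous (fun s => W s x) t.
Proof. apply W_group. Qed.

Lemma group_quotient x y :
  T y = x <->
  filterlim (fun h : R => scal (RtoC (/ h)) (minus (W h x) x)) (locally' 0) (locally y).
Proof. rewrite <- G_graph. apply W_group. Qed.

(** Invariance of the domain: applying the bounded [W t] to the quotient at [T y] gives the quotient
    at [W t (T y)], whose limit [W t y] must then be the preimage under [T]. *)
Lemma group_T_commute t y : T (W t y) = W t (T y).
Proof.
  apply group_quotient.
  pose proof (proj1 (group_quotient (T y) y) eq_refl) as H.
  eapply filterlim_ext;
    [|apply (filterlim_comp _ _ _ _ (W t) _ _ _ H),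
        (linear_cont (K := C_AbsRing) (W t) y (group_linear t))].
  intros h. simpl. pose proof (group_linear t) as Hl.
  rewrite (lin_scal _ _ _ Hl), (lin_minus _ _ _ Hl), <- !group_add.
  rewrite Rplus_comm. reflexivity.
Qed.

Lemma group_derive z t : is_derive (V := real_space X) (fun s => W s (T z)) t (W t z).
Proof.
  split; [apply (is_linear_scal_l (K := R_AbsRing))|].
  intros t' Ht'.
  rewrite <- (is_filter_lim_locally_unique (V := R_NormedModule) _ _ Ht'). clear t' Ht'.
  intros eps.
  pose proof (proj1 (group_quotient _ _) (group_T_commute t z)) as H.
  apply (filterlim_norm (V := X)) with (eps := eps) in H; [|apply cond_pos].
  destruct H as [d Hd]. exists d. intros s Hs. change R in s.
  change (norm (minus (minus (W s (T z)) (W t (T z))) (scal (RtoC (s - t)) (W t z)))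
          <= eps * Rabs (s - t)).
  destruct (Req_dec s t) as [->|Hst].
  - rewrite !minus_self, Rminus_diag, Rabs_R0.
    replace (minus (zero : X) (scal (RtoC 0) (W t z))) with (zero : X) by vec. rewrite hnorm_zero. lra.
  - specialize (Hd (s - t)). change (ball 0 d (s - t)) with (Rabs (s - t - 0) < d) in Hd.
    rewrite Rminus_0_r in Hd. specialize (Hd Hs ltac:(lra)).
    rewrite <- group_add in Hd. replace (s - t + t) with s in Hd by ring.
    replace (minus (minus (W s (T z)) (W t (T z))) (scal (RtoC (s - t)) (W t z)))
      with (scal (RtoC (s - t))
              (minus (scal (RtoC (/ (s - t))) (minus (W s (T z)) (W t (T z)))) (W t z)))
      by (vec_with ltac:(try field; lra)).
    rewrite norm_scal_eq, Rmult_comm. apply Rmult_le_compat_r; [apply Rabs_pos | apply Rlt_le, Hd].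
Qed.

(** The curve [W s (T z) = T (W s z)] has derivative [W s z], orthogonal to it by [skew_diag]. The
    passage to every [x] uses density and the bound [K] of the single operator [W t]. *)
Lemma group_isometry t x : norm (W t x) = norm x.
Proof.
  assert (HT : forall z, norm (W t (T z)) = norm (T z)).
  { intros z. rewrite <- (group_0 (T z)) at 2.
    apply (norm_constant (fun s => W s (T z)) (fun s => W s z)).
    - apply group_derive.
    - intros s. rewrite <- group_T_commute, rinner_sym. apply skew_diag. }
  destruct (linear_norm _ (group_linear t)) as [K [HK HKb]].
  assert (Hle : forall eps, 0 < eps -> Rabs (norm (W t x) - norm x) <= eps).
  { intros eps Heps. destruct (T_dense x (eps / (K + 1))) as [y [[z <-] Hz]].
    { apply Rdiv_lt_0_compat; lra. }
    set (d := minus (T z) x) in *.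
    assert (E1 : norm (W t d) <= K * norm d) by apply HKb.
    assert (E2 : (K + 1) * norm d <= eps).
    { apply Rle_trans with ((K + 1) * (eps / (K + 1))); [|right; field; lra].
      apply Rmult_le_compat_l; lra. }
    assert (E3 : norm x <= norm (T z) + norm d).
    { replace x with (minus (T z) d) at 1 by (unfold d; vec). apply norm_minus_le. }
    assert (E4 : norm (T z) <= norm x + norm d).
    { replace (T z) with (plus x d) by (unfold d; vec). apply hnorm_triangle. }
    assert (E5 : norm (W t x) <= norm (W t (T z)) + norm (W t d)).
    { replace (W t x) with (minus (W t (T z)) (W t d)); [apply norm_minus_le|].
      unfold d. rewrite (lin_minus _ _ _ (group_linear t)). vec. }
    assert (E6 : norm (W t (T z)) <= norm (W t x) + norm (W t d)).
    { replace (W t (T z)) with (plus (W t x) (W t d)); [apply hnorm_triangle|].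
      unfold d. rewrite (lin_minus _ _ _ (group_linear t)). vec. }
    rewrite HT in *. apply Rabs_le. lra. }
  apply Rminus_diag_uniq.
  destruct (Req_dec (norm (W t x) - norm x) 0) as [H|H]; [exact H|].
  apply Rabs_pos_lt in H. specialize (Hle (Rabs (norm (W t x) - norm x) / 2) ltac:(lra)). lra.
Qed.

Lemma group_integral t z :
  is_RInt (V := real_space X) (fun s => W s z) 0 t (minus (T (W t z)) (T z)).
Proof.
  replace (minus (T (W t z)) (T z)) with (minus (W t (T z)) (W 0 (T z)))
    by (rewrite group_T_commute, group_0; reflexivity).
  apply (is_RInt_derive (V := real_space X) (fun s => W s (T z)) (fun s => W s z)).
  - intros; apply group_derive.
  - intros; apply group_continuous.
Qed.

End Group.

Lemma integral_equation_trivial (w : R -> X) :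
  (forall t, continuous w t) -> w 0 = zero ->
  (forall t, is_RInt (V := real_space X) w 0 t (T (w t))) ->
  forall t, w t = zero.
Proof.
  intros Hc H0 Hi t. apply T_inj, (norm_eq_zero (V := X)).
  transitivity (norm (T (w 0))).
  - apply (norm_constant (fun s => T (w s)) w).
    + intros s. apply (is_derive_RInt (V := real_space X) w _ 0); [|apply Hc].
      apply filter_forall. exact Hi.
    + intros s. rewrite rinner_sym. apply skew_diag.
  - rewrite H0, (lin_zero _ T_linear). apply hnorm_zero.
Qed.

End Skew.

(** * The energy space *)

Section EnergySpace.
Context {X : ComplexHilbert} (L : Op X).
Implicit Types x y z : X.
Hypothesis L_linear : linear_op L.

Lemma dom_plus x y : dom L x -> dom L y -> dom L (plus x y).
Proof. intros Hx Hy. apply L_linear; assumption. Qed.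

Lemma dom_scal (c : C) x : dom L x -> dom L (scal c x).
Proof. intros Hx. apply L_linear; assumption. Qed.

Lemma op_plus x y : dom L x -> dom L y -> L (plus x y) = plus (L x) (L y).
Proof. intros Hx Hy. apply L_linear; assumption. Qed.

Lemma op_scale (c : C) x : dom L x -> L (scal c x) = scal c (L x).
Proof. intros Hx. apply L_linear; assumption. Qed.

Lemma dom_opp x : dom L x -> dom L (opp x).
Proof.
  intros Hx. replace (opp x) with (scal (RtoC (-1)) x) by vec. apply dom_scal, Hx.
Qed.

Lemma op_opp x : dom L x -> L (opp x) = opp (L x).
Proof.
  intros Hx. replace (opp x) with (scal (RtoC (-1)) x) by vec.
  rewrite op_scale by assumption. vec.
Qed.

Lemma dom_minus x y : dom L x -> dom L y -> dom L (minus x y).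
Proof. intros Hx Hy. apply (dom_plus x (opp y)); [|apply dom_opp]; assumption. Qed.

Lemma op_minus x y : dom L x -> dom L y -> L (minus x y) = minus (L x) (L y).
Proof.
  intros Hx Hy. unfold minus. rewrite <- (op_opp y) by assumption.
  apply (op_plus x (opp y)); [|apply dom_opp]; assumption.
Qed.

Lemma op_zero : L zero = zero.
Proof.
  assert (H : dom L zero) by apply L_linear.
  pose proof (op_minus zero zero H H) as E. rewrite !minus_self in E. exact E.
Qed.

(** A Riemann sum is a finite linear combination, so even an unbounded [L] passes through it. *)
Lemma op_Riemann_sum (f : R -> X) ptd :
  (forall s, dom L (f s)) ->
  dom L (Riemann_sum (V := real_module X) f ptd) /\
  L (Riemann_sum (V := real_module X) f ptd)
  = Riemann_sum (V := real_space X) (fun s => L (f s)) ptd.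
Proof.
  intros Hf. unfold Riemann_sum.
  (* [pairmap] carries the left endpoint of the current interval along, so it has to vary in the
     induction. *)
  match goal with |- context [seq.pairmap _ ?h _] => generalize h end.
  induction (SF_t ptd) as [|p l IH]; intros h; simpl.
  - split; [apply L_linear | apply op_zero].
  - destruct (IH p) as [IHd IHe].
    assert (Hd : dom L (scal (RtoC (fst p - fst h)) (f (snd p)))) by (apply dom_scal, Hf).
    split; [exact (dom_plus _ _ Hd IHd)|].
    etransitivity; [exact (op_plus _ _ Hd IHd)|].
    rewrite IHe, op_scale by apply Hf. reflexivity.
Qed.

(** [V_norm] is the norm pulled back by [L], so the sums converge in the energy space exactly when
    their images under [L] converge in [X]. *)
Lemma is_V_RInt_iff (f : R -> X) (a b : R) (I : X) :
  (forall s, dom L (f s)) -> dom L I ->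
  is_V_RInt L f a b I <-> is_RInt (V := real_space X) (fun s => L (f s)) a b (L I).
Proof.
  intros Hf HI.
  set (S := fun ptd => scal (RtoC (sign (b - a))) (Riemann_sum (V := real_module X) f ptd)).
  assert (HS : forall ptd, dom L (S ptd) /\
            L (S ptd) = scal (RtoC (sign (b - a)))
                          (Riemann_sum (V := real_space X) (fun s => L (f s)) ptd)).
  { intros ptd. destruct (op_Riemann_sum f ptd Hf) as [Hd He].
    split; [apply dom_scal, Hd|]. rewrite <- He. apply op_scale, Hd. }
  transitivity (filterlim (fun ptd => L (S ptd)) (Riemann_fine a b) (locally (L I))).
  - rewrite (filterlim_norm (V := X)). split.
    + intros [_ H] eps Heps.
      eapply filter_imp; [|apply (H (fun y => V_norm L (minus y I) < eps))].
      * intros ptd. unfold V_norm. fold (S ptd).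
        rewrite op_minus by (assumption || apply HS). easy.
      * exists (mkposreal eps Heps). easy.
    + intros H. split; [exact HI|]. intros P [eps HP].
      refine (filter_imp _ (fun ptd => P (S ptd)) _ (H eps (cond_pos eps))).
      intros ptd Hp. apply HP; [apply HS|]. unfold V_norm.
      rewrite op_minus by (assumption || apply HS). exact Hp.
  - split; apply filterlim_ext; intros ptd; rewrite (proj2 (HS ptd)); reflexivity.
Qed.

Lemma V_continuous_iff (f : R -> X) :
  V_continuous L f <->
  (forall t, dom L (f t)) /\ (forall t, continuous (fun s => L (f s)) t).
Proof.
  split; intros [Hd Hc]; (split; [exact Hd|]); intros t.
  - apply (filterlim_norm (V := X)). intros eps Heps.
    eapply filter_imp; [|apply (Hc t (fun y => V_norm L (minus y (f t)) < eps))].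
    + intros s. unfold V_norm. rewrite op_minus by apply Hd. easy.
    + exists (mkposreal eps Heps). easy.
  - intros P [eps HP].
    pose proof (proj1 (filterlim_norm (V := X) _ _) (Hc t) eps (cond_pos eps)) as H.
    refine (filter_imp _ (fun s => P (f s)) _ H).
    intros s Hs. apply HP; [apply Hd|]. unfold V_norm. rewrite op_minus by apply Hd. exact Hs.
Qed.

End EnergySpace.

(** * The flow *)
Section Setting.
Context {X : ComplexHilbert} (B L : Op X) (J S : X -> X).
Implicit Types x y z : X.
Hypothesis L_selfadjoint : selfadjoint L.
Hypothesis L_sqr : op_eq (op_comp L L) B.
Hypothesis J_linear : is_linear J.
Hypothesis J_adj : forall x y, inner (J x) y = inner x (opp (J y)).
Hypothesis J_sqr : forall x, J (J x) = opp x.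
Hypothesis S_linear : is_linear S.
Hypothesis S_right : forall y, dom B (S y) /\ B (S y) = y.
Hypothesis S_left : forall x, dom B x -> S (B x) = x.

Let L_linear : linear_op L := proj1 L_selfadjoint.

Lemma L_symmetric x y : dom L x -> dom L y -> rinner (L x) y = rinner x (L y).
Proof.
  intros Hx Hy. unfold rinner. f_equal.
  apply (proj2 (proj2 (proj2 L_selfadjoint) y (L y))); auto.
Qed.

(** [L^{-1}], since [S = B^{-1} = L^{-1} L^{-1}]. *)
Definition L_inv y : X := L (S y).

Lemma L_S y : dom L (S y) /\ dom L (L_inv y) /\ L (L_inv y) = y.
Proof.
  destruct (S_right y) as [Hd He]. apply L_sqr in Hd.
  destruct Hd as [H1 H2]. repeat split; [exact H1 | exact H2|].
  rewrite <- He at 2. apply (proj2 L_sqr (S y)). split; assumption.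
Qed.

Lemma dom_L_inv y : dom L (L_inv y).
Proof. apply L_S. Qed.

Lemma L_L_inv y : L (L_inv y) = y.
Proof. apply L_S. Qed.

(** [L x = 0] puts [x] in the domain of [L L], hence of [B], with [B x = 0]; the left inverse [S]
    then gives [x = 0]. *)
Lemma L_kernel x : dom L x -> L x = zero -> x = zero.
Proof.
  intros Hx H0. assert (HLL : dom (op_comp L L) x).
  { split; [exact Hx|]. rewrite H0. apply L_linear. }
  rewrite <- (S_left x) by (apply L_sqr, HLL).
  rewrite <- (proj2 L_sqr x HLL). simpl.
  rewrite H0, (op_zero L L_linear). apply lin_zero, S_linear.
Qed.

Lemma L_injective x y : dom L x -> dom L y -> L x = L y -> x = y.
Proof.
  intros Hx Hy H. apply minus_eq_0, L_kernel.
  - apply dom_minus; assumption.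
  - rewrite (op_minus L L_linear), H by assumption. apply minus_self.
Qed.

Lemma L_inv_unique x y : dom L x -> L x = y -> L_inv y = x.
Proof.
  intros Hx H. apply L_injective; [apply dom_L_inv | exact Hx|].
  rewrite L_L_inv. symmetry; exact H.
Qed.

Lemma op_inv_L y : op_inv L y = L_inv y.
Proof.
  destruct (epsilon_spec (inhabits zero) (fun x => dom L x /\ L x = y)) as [Hd He].
  - exists (L_inv y). split; [apply dom_L_inv | apply L_L_inv].
  - symmetry. apply L_inv_unique; assumption.
Qed.

Lemma L_inv_linear : is_linear L_inv.
Proof.
  split.
  - intros x y. apply L_inv_unique; [apply (dom_plus L L_linear); apply dom_L_inv|].
    etransitivity; [apply (op_plus L L_linear); apply dom_L_inv|]. rewrite !L_L_inv. reflexivity.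
  - intros c x. apply L_inv_unique; [apply (dom_scal L L_linear), dom_L_inv|].
    etransitivity; [apply (op_scale L L_linear), dom_L_inv|]. rewrite L_L_inv. reflexivity.
  - destruct (linear_norm _ S_linear) as [M [HM HMb]].
    (* Symmetry of [L] gives [norm (L_inv y) ^ 2 = rinner (S y) y <= M norm y ^ 2]; the inequality
       [M <= (M + 1) ^ 2] avoids a square root. *)
    exists (M + 1). split; [lra|]. intros y.
    assert (H : norm (L_inv y) ^ 2 <= M * norm y ^ 2).
    { rewrite <- rinner_norm. destruct (L_S y) as [H1 [H2 H3]]. unfold L_inv at 1.
      rewrite L_symmetric, H3 by assumption.
      eapply Rle_trans; [apply rinner_le|]. simpl. rewrite Rmult_1_r, <- Rmult_assoc.
      apply Rmult_le_compat_r; [apply hnorm_ge_0 | apply HMb]. }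
    pose proof (hnorm_ge_0 y). pose proof (hnorm_ge_0 (L_inv y)).
    apply Rsqr_incr_0_var; [|apply Rmult_le_pos; lra].
    unfold Rsqr. pose proof (pow2_ge_0 (norm y)). nra.
Qed.

Lemma L_inv_symmetric x y : rinner (L_inv x) y = rinner x (L_inv y).
Proof.
  rewrite <- (L_L_inv y) at 1. rewrite <- L_symmetric by apply dom_L_inv.
  rewrite L_L_inv. reflexivity.
Qed.

(** [(-iH)^{-1}], which is bounded even though [H] is not. *)
Definition gen_inv x : X := opp (L_inv (J (L_inv x))).

Lemma dom_gen_inv x : dom L (gen_inv x).
Proof. apply (dom_opp L L_linear), dom_L_inv. Qed.

Lemma gen_inv_linear : is_linear gen_inv.
Proof.
  assert (H : is_linear (fun x => L_inv (J (L_inv x)))).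
  { apply (is_linear_comp (fun x => J (L_inv x)) L_inv); [|apply L_inv_linear].
    apply (is_linear_comp L_inv J); [apply L_inv_linear | apply J_linear]. }
  destruct (linear_norm _ H) as [M [HM HMb]]. unfold gen_inv. split.
  - intros x y. etransitivity; [apply f_equal, (lin_plus _ x y H)|]. vec.
  - intros c x. etransitivity; [apply f_equal, (lin_scal _ c x H)|]. vec.
  - exists M. split; [exact HM|]. intros x. rewrite hnorm_opp. apply HMb.
Qed.

Lemma gen_inv_skew x y : rinner (gen_inv x) y = - rinner x (gen_inv y).
Proof.
  assert (HJ : forall u v, rinner (J u) v = - rinner u (J v)).
  { intros u v. rewrite <- rinner_opp_r. unfold rinner. rewrite J_adj. reflexivity. }
  unfold gen_inv. rewrite rinner_opp_l, rinner_opp_r.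
  rewrite L_inv_symmetric, HJ, L_inv_symmetric. reflexivity.
Qed.

Lemma gen_inv_inj x : gen_inv x = zero -> x = zero.
Proof.
  intros H.
  assert (H1 : L_inv (J (L_inv x)) = zero).
  { replace (L_inv (J (L_inv x))) with (opp (gen_inv x)) by (unfold gen_inv; vec). rewrite H. vec. }
  assert (H2 : J (L_inv x) = zero).
  { rewrite <- (L_L_inv (J (L_inv x))), H1. apply op_zero, L_linear. }
  assert (H3 : L_inv x = zero).
  { replace (L_inv x) with (opp (J (J (L_inv x)))) by (rewrite J_sqr; vec).
    rewrite H2, (lin_zero _ J_linear). vec. }
  rewrite <- (L_L_inv x), H3. apply op_zero, L_linear.
Qed.

(** A vector [u] of the dense domain of [L] is [L_inv J (- J L u)]. Replacing [- J L u] by a nearby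
    [v = L_inv (L v)] in that domain gives [L_inv J L_inv (L v) = gen_inv (- L v)], and [L_inv J] is
    bounded. *)
Lemma gen_inv_dense : dense (fun y => exists x, gen_inv x = y).
Proof.
  assert (HJL : is_linear (fun x => L_inv (J x))).
  { apply (is_linear_comp J L_inv); [apply J_linear | apply L_inv_linear]. }
  destruct (linear_norm _ HJL) as [K [HK HKb]].
  pose proof (proj1 (proj2 L_selfadjoint)) as Hdense.
  intros x eps Heps.
  destruct (Hdense x (eps / 2)) as [u [Hu Hux]]; [lra|].
  destruct (Hdense (opp (J (L u))) (eps / 2 / K)) as [v [Hv Hvu]].
  { apply Rdiv_lt_0_compat; lra. }
  exists (gen_inv (opp (L v))). split; [eauto|].
  assert (E : minus (gen_inv (opp (L v))) x
              = plus (L_inv (J (minus v (opp (J (L u)))))) (minus u x)).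
  { rewrite (lin_minus _ _ _ J_linear), (lin_opp _ _ J_linear), J_sqr.
    rewrite (lin_minus _ _ _ L_inv_linear), !(lin_opp _ _ L_inv_linear).
    rewrite (L_inv_unique u (L u)) by auto.
    unfold gen_inv. rewrite (lin_opp _ _ L_inv_linear), (L_inv_unique v (L v)) by auto.
    rewrite (lin_opp _ _ J_linear), (lin_opp _ _ L_inv_linear). vec. }
  rewrite E. eapply Rle_lt_trans; [apply hnorm_triangle|].
  pose proof (HKb (minus v (opp (J (L u))))) as Hb.
  apply (Rmult_lt_compat_l K) in Hvu; [|lra].
  replace (K * (eps / 2 / K)) with (eps / 2) in Hvu by (field; lra). lra.
Qed.

(** Since [-i] times [i] is 1, the generator acts as [L J L], and [J J = -1] turns its inverse into
    [- L_inv J L_inv]. The domains match exactly, as [is_C0_group] requires. *)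
Lemma generator_graph x y :
  (dom (op_scal (Copp Ci) (op_H L J)) x /\ op_scal (Copp Ci) (op_H L J) x = y)
  <-> gen_inv y = x.
Proof.
  simpl. split.
  - intros [[[Hx _] Hd] <-].
    (* The domain of [op_H] constrains [i J L x]; multiplying by [-i] removes the factor. *)
    rewrite (op_scale L L_linear) by
      (replace (J (L x)) with (scal (Copp Ci) (scal Ci (J (L x)))) by vec;
       apply (dom_scal L L_linear), Hd).
    assert (Hd' : dom L (J (L x))).
    { replace (J (L x)) with (scal (Copp Ci) (scal Ci (J (L x)))) by vec.
      apply (dom_scal L L_linear), Hd. }
    replace (scal (Copp Ci) (scal Ci (L (J (L x))))) with (L (J (L x))) by vec.
    unfold gen_inv. rewrite (L_inv_unique (J (L x)) _ Hd' eq_refl), J_sqr.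
    rewrite (lin_opp _ _ L_inv_linear), (L_inv_unique x _ Hx eq_refl). vec.
  - intros <-.
    assert (E : J (L (gen_inv y)) = L_inv y).
    { unfold gen_inv. rewrite (op_opp L L_linear), L_L_inv by apply dom_L_inv.
      rewrite (lin_opp _ _ J_linear), J_sqr. vec. }
    rewrite E. repeat split.
    + apply dom_gen_inv.
    + apply (dom_scal L L_linear), dom_L_inv.
    + rewrite (op_scale L L_linear), L_L_inv by apply dom_L_inv. vec.
Qed.

(** * The unitary group, the flow and the integral equation *)

Let U : R -> X -> X := op_exp (op_scal (Copp Ci) (op_H L J)).

(** The choice behind [op_exp] is meaningful once some group is generated; [skew_group gen_inv] is
    such a group. *)
Lemma U_group : is_C0_group (op_scal (Copp Ci) (op_H L J)) U.
Proof.
  apply (epsilon_spec (inhabits (fun _ x => x)) (is_C0_group _)).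
  exists (skew_group gen_inv).
  apply (skew_generates_group gen_inv gen_inv_linear gen_inv_skew gen_inv_inj gen_inv_dense), generator_graph.
Qed.

Lemma U_isometry t x : norm (U t x) = norm x.
Proof.
  apply (group_isometry gen_inv gen_inv_skew gen_inv_dense _ U generator_graph U_group).
Qed.

Lemma U_linear t : is_linear (U t).
Proof. apply (group_linear _ U U_group). Qed.

Lemma flow_eq t x : flow L J t x = L_inv (U t (L x)).
Proof. apply op_inv_L. Qed.

Lemma dom_flow t x : dom L (flow L J t x).
Proof. rewrite flow_eq. apply dom_L_inv. Qed.

Lemma L_flow t x : L (flow L J t x) = U t (L x).
Proof. rewrite flow_eq. apply L_L_inv. Qed.

Lemma flow_0 x : dom L x -> flow L J 0 x = x.
Proof.
  intros Hx. rewrite flow_eq, (group_0 _ U U_group). apply L_inv_unique; auto.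
Qed.

(** [A^{-1} = B^{-1} J^{-1} = - S J]. As [op_inv] picks some preimage, both existence and uniqueness
    of one are checked. *)
Lemma op_inv_A y : op_inv (op_A B J) y = opp (S (J y)).
Proof.
  destruct (epsilon_spec (inhabits zero)
              (fun x => dom (op_A B J) x /\ op_A B J x = y)) as [[Hd _] He].
  - exists (opp (S (J y))). destruct (S_right (opp (J y))) as [Hd He].
    rewrite <- (lin_opp _ _ S_linear). repeat split; [exact Hd|]. simpl.
    rewrite He, (lin_opp _ _ J_linear), J_sqr. vec.
  - change (op_inv (op_A B J) y) with
      (epsilon (inhabits zero) (fun x => dom (op_A B J) x /\ op_A B J x = y)).
    set (x := epsilon _ _) in *. simpl in He.
    rewrite <- (S_left x Hd), <- He, J_sqr, (lin_opp _ _ S_linear). vec.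
Qed.

(** [L A^{-1} y = - L S J y = - L_inv J L_inv (L y)]: conjugation by [L] turns the inverse of [A]
    into that of [-iH]. *)
Lemma L_op_inv_A y :
  dom L y -> dom L (op_inv (op_A B J) y) /\ L (op_inv (op_A B J) y) = gen_inv (L y).
Proof.
  intros Hy. rewrite op_inv_A. split.
  - apply (dom_opp L L_linear), L_S.
  - rewrite (op_opp L L_linear) by apply L_S.
    unfold gen_inv. rewrite (L_inv_unique y (L y)) by auto. reflexivity.
Qed.

Lemma V_solution_iff (f : R -> X) :
  (forall t, dom L (f t)) ->
  V_solution B L J f <->
  forall t, is_RInt (V := real_space X) (fun s => L (f s)) 0 t
              (minus (gen_inv (L (f t))) (gen_inv (L (f 0)))).
Proof.
  intros Hf.
  assert (H : forall t, is_V_RInt L f 0 t (op_inv (op_A B J) (minus (f t) (f 0))) <->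
    is_RInt (V := real_space X) (fun s => L (f s)) 0 t
      (minus (gen_inv (L (f t))) (gen_inv (L (f 0))))).
  { intros t. destruct (L_op_inv_A (minus (f t) (f 0))) as [Hd He].
    { apply dom_minus; auto. }
    rewrite (is_V_RInt_iff L L_linear) by assumption.
    rewrite He, (op_minus L L_linear), (lin_minus _ _ _ gen_inv_linear) by auto. reflexivity. }
  split; intros Hs t; apply H, Hs.
Qed.

Lemma flow_V_continuous x : V_continuous L (fun t => flow L J t x).
Proof.
  apply (V_continuous_iff L L_linear). split; [intros t; apply dom_flow|]. intros t.
  apply (continuous_ext (fun s => U s (L x))).
  - intros s. symmetry. apply L_flow.
  - apply (group_continuous _ U U_group).
Qed.

Lemma flow_V_solution x : dom L x -> V_solution B L J (fun t => flow L J t x).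
Proof.
  intros Hx. apply V_solution_iff; [intros t; apply dom_flow|]. intros t.
  rewrite flow_0, L_flow by assumption.
  apply (is_RInt_ext (V := real_space X) (fun s => U s (L x))).
  - intros s _. symmetry. apply L_flow.
  - apply (group_integral gen_inv _ U generator_graph U_group).
Qed.

Lemma flow_unique x (Y : R -> X) :
  V_continuous L Y -> Y 0 = x -> V_solution B L J Y -> forall t, Y t = flow L J t x.
Proof.
  intros HY H0 Hsol t.
  destruct (proj1 (V_continuous_iff L L_linear Y) HY) as [Hd Hc].
  assert (Hx : dom L x) by (rewrite <- H0; apply Hd).
  apply L_injective; [apply Hd | apply dom_flow|]. rewrite L_flow.
  apply minus_eq_0.
  apply (integral_equation_trivial gen_inv gen_inv_linear gen_inv_skew gen_inv_inj
           (fun s => minus (L (Y s)) (U s (L x)))).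
  - intros s. apply (continuous_minus (V := X)); [apply Hc|].
    apply (group_continuous _ U U_group).
  - rewrite H0, (group_0 _ U U_group). apply minus_self.
  - intros s.
    pose proof (proj1 (V_solution_iff Y Hd) Hsol s) as H1.
    pose proof (group_integral gen_inv _ U generator_graph U_group s (L x)) as H2.
    pose proof (is_RInt_minus (V := real_space X) _ _ _ _ _ _ H1 H2) as H3.
    (* Both solutions start at [x], so the initial terms cancel in the difference. *)
    rewrite H0 in H3. rewrite (lin_minus _ _ _ gen_inv_linear).
    replace (minus (gen_inv (L (Y s))) (gen_inv (U s (L x)))) with
      (minus (minus (gen_inv (L (Y s))) (gen_inv (L x))) (minus (gen_inv (U s (L x))) (gen_inv (L x)))) by vec.
    exact H3.
Qed.

Lemma flow_add s t x : flow L J (s + t) x = flow L J s (flow L J t x).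
Proof.
  rewrite (flow_eq (s + t)), (flow_eq s), L_flow, (group_add _ U U_group). reflexivity.
Qed.

Lemma flow_V_norm t x : V_norm L (flow L J t x) = V_norm L x.
Proof. unfold V_norm. rewrite L_flow. apply U_isometry. Qed.

Lemma flow_V_unitary t : V_unitary L (flow L J t).
Proof.
  repeat split.
  - intros x _. apply dom_flow.
  - intros x y Hx Hy. rewrite !flow_eq, (op_plus L L_linear) by assumption.
    rewrite (lin_plus _ _ _ (U_linear t)). apply lin_plus, L_inv_linear.
  - intros c x Hx. rewrite !flow_eq, (op_scale L L_linear) by assumption.
    rewrite (lin_scal _ _ _ (U_linear t)). apply lin_scal, L_inv_linear.
  (* Surjectivity: the preimage of [y] is its evolution by time [-t]. *)
  - intros y Hy. exists (flow L J (- t) y). split; [apply dom_flow|].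
    rewrite <- flow_add, Rplus_opp_r. apply flow_0, Hy.
  - intros x y _ _. rewrite !L_flow.
    apply linear_isometry_inner; [apply U_linear | apply U_isometry].
Qed.

End Setting.

Theorem lemma2p3
  (X : ComplexHilbert) (B L : Op X) (J : X -> X) (delta : R)
  (hB : selfadjoint B)
  (hJ : is_linear J)
  (hJadj : forall x y, inner (J x) y = inner x (opp (J y)))
  (hJ2 : forall x, J (J x) = opp x)
  (hL : is_positive_sqrt B L)
  (hdelta : 0 < delta)
  (hspec : forall z : C, spectrum B z -> exists r : R, z = RtoC r /\ delta <= r) :
  (forall X0 : X, dom L X0 ->
     V_continuous L (fun t => flow L J t X0) /\
     flow L J 0 X0 = X0 /\
     V_solution B L J (fun t => flow L J t X0) /\
     (forall Y : R -> X,
        V_continuous L Y -> Y 0 = X0 -> V_solution B L J Y ->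
        forall t, Y t = flow L J t X0)) /\
  ((forall X0 : X, dom L X0 -> flow L J 0 X0 = X0) /\
   (forall (s t : R) (X0 : X), dom L X0 ->
      flow L J (s + t) X0 = flow L J s (flow L J t X0)) /\
   (forall t : R, V_unitary L (flow L J t)) /\
   (forall (t : R) (X0 : X), dom L X0 ->
      V_norm L (flow L J t X0) = V_norm L X0)).
Proof.
  destruct hL as [hLsa [_ hLL]].
  (* [0 < delta] keeps 0 out of the spectrum; the spectrum being a negation, membership in the
     resolvent set follows classically and supplies the bounded inverse [S] of [B]. *)
  assert (hres : resolvent_set B (RtoC 0)).
  { apply NNPP. intros H. destruct (hspec _ H) as [r [Hr Hd]].
    apply RtoC_inj in Hr. lra. }
  destruct hres as [S [HS [HSr HSl]]].
  assert (HSr' : forall y, dom B (S y) /\ B (S y) = y).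
  { intros y. destruct (HSr y) as [Hd He]. split; [exact Hd|].
    rewrite <- He at 2. vec. }
  assert (HSl' : forall x, dom B x -> S (B x) = x).
  { intros x Hx. rewrite <- (HSl x Hx) at 2. f_equal. vec. }
  split; [|split; [|split; [|split]]].
  - intros X0 H0. split; [|split; [|split]].
    + eapply flow_V_continuous; eassumption.
    + eapply flow_0; eassumption.
    + eapply flow_V_solution; eassumption.
    + intros Y. eapply flow_unique; eassumption.
  - intros X0 H0. eapply flow_0; eassumption.
  - intros s t X0 _. eapply flow_add; eassumption.
  - intros t. eapply flow_V_unitary; eassumption.
  - intros t X0 _. eapply flow_V_norm; eassumption.
Qed.
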